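(* Assume all rows $A_i$ of $A$ are nonzero and let $\gamma\in(0,1)$. Run the dense PURE-CD algorithm (described in the context) with, for all $k\ge 0$, $$\mathrm{T}_k=\tau I,\quad \tau=\frac{1}{\sum_{i=1}^n\|A_i\|},\quad \Sigma_k=\Sigma=\mathrm{diag}(\sigma^{(1)},\dots,\sigma^{(n)}),\quad \sigma^{(i)}=\frac{\gamma}{\|A_i\|},\quad p^{(i)}=\frac{\|A_i\|}{\sum_{l=1}^n\|A_l\|},\quad \Theta_k=I .$$ For $K\ge 1$ let $x^K=\frac1K\sum_{k=1}^K\bar x_k$. Let $(x_\star,y_\star)$ be a saddle point of $L$. Then: (Case 1) If $h:\mathbb{R}^n\to\mathbb{R}$ is $L_h$-Lipschitz continuous (Euclidean norm), then $$\mathbb{E}\left[h(Ax^K)+g(x^K)-h(Ax_\star)-g(x_\star)\right]\le \frac{2\sum_{i=1}^n\|A_i\|}{K\gamma(1-\gamma)}\left(4L_h^2+\|x_\star-x_0\|^2\right).$$ (Case 2) If $h=\delta_C$, where $C=C_1\times\dots\times C_n\subseteq\mathbb{R}^n$ is nonempty, closed and convex, then $$\mathbb{E}|g(x^K)-g(x_\star)|\le \frac{8\sum_{i=1}^n\|A_i\|}{K\gamma(1-\gamma)}\Big[\big(\|x_\star-x_0\|+\|y_\star-y_0\|+\|y_0\|+\|y_\star\|\big)\|y_\star\|+D_\star+\|y_0\|^2\Big],$$ $$\mathbb{E}\left[\mathrm{dist}(Ax^K,C)\right]\le \frac{8\sum_{i=1}^n\|A_i\|}{K\gamma(1-\ga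mma)}\big(\|x_\star-x_0\|+\|y_\star-y_0\|+\|y_0\|+\|y_\star\|\big).$$
   Context: Problem: $\min_{x\in\mathbb{R}^d}\max_{y\in\mathbb{R}^n} L(x,y)$ with $L(x,y)=\langle Ax,y\rangle-h^*(y)+g(x)$, where $A\in\mathbb{R}^{n\times d}$ has rows $A_1,\dots,A_n$, $g:\mathbb{R}^d\to(-\infty,+\infty]$ and $h^*:\mathbb{R}^n\to(-\infty,+\infty]$ are proper convex lower semicontinuous, and $h^*(y)=\sum_{i=1}^n h_i^*(y^{(i)})$ is separable ($y^{(i)}$ is the $i$-th coordinate). $h_i$ is the convex conjugate of $h_i^*$ and $h(z)=\sum_i h_i(z^{(i)})$. It is assumed that a saddle point $(x_\star,y_\star)$ exists: $L(x,y_\star)\ge L(x_\star,y_\star)\ge L(x_\star,y)$ for all $x,y$. Notation: $\|\cdot\|$ is the Euclidean norm. $\delta_C$ is the indicator function ($0$ on $C$, $+\infty$ outside); $\mathrm{dist}(\cdot,C)$ is the Euclidean distance to $C$. For a positive diagonal matrix $\mathrm{T}$, $\|x\|_{\mathrm{T}}^2=\langle x,\mathrm{T}x\rangle$ and $\mathrm{prox}_{\mathrm{T},g}(x)=\arg\min_u\{g(u)+\frac12\|u-x\|^2_{\mathrm{T}^{-1}}\}$. $D_\star=\min(\|x_\star-x_0\|^2+\|y_\star-y_0\|^2)$, the minimum being over all saddle points $(x_\star,y_\star)$. Dense PURE-CD algorithm: start from deterministic $x_0\in\mathrm{dom}\,g$, $y_0\in\mathrm{dom}\,h^*$. Given positive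 diagonal matrices $\mathrm{T}_k$ ($d\times d$), $\Sigma_k=\mathrm{diag}(\sigma_k^{(1)},\dots,\sigma_k^{(n)})$, $\Theta_k$ ($d\times d$), and probabilities $p^{(i)}>0$ summing to one with $P=\mathrm{diag}(p^{(1)},\dots,p^{(n)})$, for $k=0,1,\dots$: 1. $\bar x_{k+1}=\mathrm{prox}_{\mathrm{T}_k,g}(x_k-\mathrm{T}_kA^\top y_k)$; 2. pick $i_k\in\{1,\dots,n\}$, independently of the past, with $\Pr(i_k=i)=p^{(i)}$; 3. $y_{k+1}^{(i_k)}=\mathrm{prox}_{\sigma_k^{(i_k)},h_{i_k}^*}\big(y_k^{(i_k)}+\sigma_k^{(i_k)}A_{i_k}\bar x_{k+1}\big)$ and $y_{k+1}^{(i)}=y_k^{(i)}$ for $i\ne i_k$; 4. $x_{k+1}=\bar x_{k+1}-\mathrm{T}_k\Theta_kA^\top P^{-1}(y_{k+1}-y_k)$. *)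

(* Defs.v *)
From HB Require Import structures.
From mathcomp Require Import all_boot all_order all_algebra.
From mathcomp Require Import all_classical all_reals all_analysis.

Set Implicit Arguments.
Unset Strict Implicit.
Unset Printing Implicit Defensive.

Import Order.TTheory GRing.Theory Num.Theory.
Import numFieldNormedType.Exports.

Local Open Scope classical_set_scope.
Local Open Scope ring_scope.

Definition dotv (R : realType) (m : nat) (u v : 'cV[R]_m) : R :=
  \sum_(i < m) u i 0 * v i 0.

(* The norm the library puts on matrices is the max norm, hence this one. *)
Definition enorm (R : realType) (m : nat) (u : 'cV[R]_m) : R :=
  Num.sqrt (dotv u u).

Definition wnorm2 (R : realType) (m : nat) (T : 'M[R]_m) (u : 'cV[R]_m) : R :=
  dotv u (T *m u).

Definition row_norm (R : realType) (n d : nat) (A : 'M[R]_(n, d)) (i : 'I_n) : R :=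
  enorm (row i A)^T.

Definition dist (R : realType) (m : nat) (z : 'cV[R]_m) (C : set 'cV[R]_m) : R :=
  inf [set enorm (z - c) | c in C].

Section ConvexAnalysis.
Local Open Scope ereal_scope.

Definition eproper (V : Type) (R : realType) (f : V -> \bar R) : Prop :=
  (forall x, f x != -oo) /\ (exists x, f x < +oo).

(* Only used for functions that never take the value -oo; 0 * +oo = 0. *)
Definition econvex (R : realType) (V : lmodType R) (f : V -> \bar R) : Prop :=
  forall (x y : V) (t : R), (0 <= t <= 1)%R ->
    f (t *: x + (1 - t) *: y)%R <= t%:E * f x + (1 - t)%:E * f y.

Definition edom (V : Type) (R : realType) (f : V -> \bar R) : set V :=
  [set x | f x < +oo].

Definition argmin (V : Type) (R : realType) (f : V -> \bar R) : set V :=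
  [set u | forall v, f u <= f v].

Definition delta (V : Type) (R : realType) (C : set V) (z : V) : \bar R :=
  if z \in C then 0 else +oo.

Definition conjugate (R : realType) (f : R -> \bar R) (z : R) : \bar R :=
  ereal_sup [set (z * y)%:E - f y | y in [set: R]].

Definition separable_sum (R : realType) (n : nat) (f : 'I_n -> R -> \bar R)
    (y : 'cV[R]_n) : \bar R :=
  \sum_(i < n) f i (y i ord0).

Definition prox (R : realType) (m : nat) (T : 'M[R]_m) (f : 'cV[R]_m -> \bar R)
    (x : 'cV[R]_m) : set 'cV[R]_m :=
  argmin (fun u => f u + (2^-1 * wnorm2 (invmx T) (u - x))%:E).

Definition sprox (R : realType) (s : R) (f : R -> \bar R) (z : R) : set R :=
  argmin (fun u => f u + (2^-1 * (s^-1 * (u - z) ^+ 2))%:E).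

(* When g x = +oo and hstar y = +oo, this is -oo by the library's convention
   on +oo - oo. The convention does not influence the saddle points: for
   proper g and hstar, g and hstar are finite at a saddle point. *)
Definition lagrangian (R : realType) (n d : nat) (A : 'M[R]_(n, d))
    (g : 'cV[R]_d -> \bar R) (hstar : 'cV[R]_n -> \bar R)
    (x : 'cV[R]_d) (y : 'cV[R]_n) : \bar R :=
  (dotv (A *m x) y)%:E - hstar y + g x.

Definition saddle_point (V W : Type) (R : realType) (L : V -> W -> \bar R)
    (xs : V) (ys : W) : Prop :=
  (forall x, L xs ys <= L x ys) /\ (forall y, L xs y <= L xs ys).

Definition Dstar (R : realType) (n d : nat)
    (L : 'cV[R]_d -> 'cV[R]_n -> \bar R) (x0 : 'cV[R]_d) (y0 : 'cV[R]_n) : R :=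
  inf [set (enorm (z.1 - x0) ^+ 2 + enorm (z.2 - y0) ^+ 2)%R
      | z in [set z | saddle_point L z.1 z.2]].

End ConvexAnalysis.

(* xbar k.+1 is computed from the k-th iterates; xbar 0 is irrelevant. *)
Definition pure_cd (R : realType) (n d : nat) (A : 'M[R]_(n, d))
    (g : 'cV[R]_d -> \bar R) (hs : 'I_n -> R -> \bar R)
    (T : nat -> 'M[R]_d) (Sigma : nat -> 'M[R]_n) (Theta : nat -> 'M[R]_d)
    (p : 'I_n -> R) (x0 : 'cV[R]_d) (y0 : 'cV[R]_n) (idx : nat -> 'I_n)
    (x xbar : nat -> 'cV[R]_d) (y : nat -> 'cV[R]_n) : Prop :=
  [/\ x 0%N = x0, y 0%N = y0 &
   forall k : nat,
   [/\ prox (T k) g (x k - T k *m A^T *m y k) (xbar k.+1),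
       sprox (Sigma k (idx k) (idx k)) (hs (idx k))
         (y k (idx k) 0 + Sigma k (idx k) (idx k) * (A *m xbar k.+1) (idx k) 0)
         (y k.+1 (idx k) 0),
       (forall i : 'I_n, i != idx k -> y k.+1 i 0 = y k i 0) &
       x k.+1 = xbar k.+1
         - T k *m Theta k *m A^T *m invmx (diag_mx (\row_i p i))
             *m (y k.+1 - y k)]].

(* The events [set w | H [tuple idx l w | l < k]] are those of the sigma-algebra
   generated by idx 0, ..., idx k.-1, that is, of the past of step k. *)
Definition random_indices (disp : measure_display) (Omega : measurableType disp)
    (R : realType) (P : probability Omega R) (n : nat) (p : 'I_n -> R)
    (idx : nat -> Omega -> 'I_n) : Prop :=
  [/\ forall k i, measurable [set w | idx k w = i],
      forall k i, P [set w | idx k w = i] = (p i)%:E &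
      forall (k : nat) (H : set (k.-tuple 'I_n)) (i : 'I_n),
        P ([set w | H [tuple idx l w | l < k]] `&` [set w | idx k w = i])
        = (P [set w | H [tuple idx l w | l < k]] * P [set w | idx k w = i])%E].

Definition ergodic_mean (R : realType) (d : nat) (xbar : nat -> 'cV[R]_d)
    (K : nat) : 'cV[R]_d :=
  K%:R^-1 *: \sum_(1 <= k < K.+1) xbar k.

(* Main.v *)
(** With [M] the martingale part of the accumulated dual steps and
    [G = S / gamma], the quantity
      S |x_k - x|^2 + G |y_k - y|^2 + (G - S) |M_k|^2
    decreases in conditional expectation, up to twice a gap term.  The point
    [A xbar_(k+1) - Sigma^-1 (yhat - y_k)], where [yhat] is the full dual step,
    is a subgradient of h* at [yhat]; so h of it is explicit, and the average of
    these points differs from [A x^K] by [G / K] times the accumulated mean dual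
    steps, which [y_K] and [M_K] control.  Comparing h at [A x^K] with h at this
    average (Lipschitz case), or using that the average lies in [C] (indicator
    case), replaces the usual supremum over a random dual point: the potential
    is only ever used at [y = 0] and at the given saddle point. *)

Require Import Defs.
From mathcomp Require Import all_boot all_order all_algebra.
From mathcomp Require Import all_classical all_reals all_analysis.
From mathcomp Require Import ring lra.

Set Implicit Arguments.
Unset Strict Implicit.
Unset Printing Implicit Defensive.

Import Order.TTheory GRing.Theory Num.Theory.
Import numFieldNormedType.Exports.

Local Open Scope classical_set_scope.
Local Open Scope ring_scope.

(** The weights of the potential come from counting second moments. Sampling rows in proportion to
    their norms turns the second moments of the random primal correction, of the dual step and of
    the drawn part of the increment of [M] into the same form [sum_i p_i * D_i ^ 2], with weights
    [S], [G] and [G - S]. They add up to [2 * G], which is exactly what the optimality of the full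
    dual step pays back through [Sigma^-1], whose diagonal is [G * p_i]. So
    [G - S = G * (1 - gamma)] is the weight left over for [M], and it is the source of the factor
    [1 / (1 - gamma)] in the rates. A dual point that depends on the draws cannot enter the
    potential, because the decrease holds in conditional expectation with that point held fixed. A
    run is given by relations between arbitrary functions on [Omega]. Uniqueness of proximal points
    makes every iterate a function of the finite word of drawn indices, so that all expectations
    become finite sums over words. *)

(** * Euclidean inner product and norm on column vectors *)

Section Euclidean.
Context {R : realType}.
Implicit Types m n : nat.

Lemma dotvC m (u v : 'cV[R]_m) : dotv u v = dotv v u.
Proof. by apply: eq_bigr => i _; rewrite mulrC. Qed.

Lemma dotvDl m (u v w : 'cV[R]_m) : dotv (u + v) w = dotv u w + dotv v w.
Proof. by rewrite -big_split; apply: eq_bigr => i _; rewrite mxE mulrDl. Qed.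

Lemma dotvZl m a (u v : 'cV[R]_m) : dotv (a *: u) v = a * dotv u v.
Proof. by rewrite mulr_sumr; apply: eq_bigr => i _; rewrite mxE mulrA. Qed.

Lemma dotvDr m (u v w : 'cV[R]_m) : dotv w (u + v) = dotv w u + dotv w v.
Proof. by rewrite !(dotvC w) dotvDl. Qed.

Lemma dotvZr m a (u v : 'cV[R]_m) : dotv v (a *: u) = a * dotv v u.
Proof. by rewrite !(dotvC v) dotvZl. Qed.

Lemma dotvNl m (u v : 'cV[R]_m) : dotv (- u) v = - dotv u v.
Proof. by rewrite -scaleN1r dotvZl mulN1r. Qed.

Lemma dotvNr m (u v : 'cV[R]_m) : dotv v (- u) = - dotv v u.
Proof. by rewrite !(dotvC v) dotvNl. Qed.

Lemma dotvBl m (u v w : 'cV[R]_m) : dotv (u - v) w = dotv u w - dotv v w.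
Proof. by rewrite dotvDl dotvNl. Qed.

Lemma dotvBr m (u v w : 'cV[R]_m) : dotv w (u - v) = dotv w u - dotv w v.
Proof. by rewrite dotvDr dotvNr. Qed.

Lemma dot0v m (v : 'cV[R]_m) : dotv 0 v = 0.
Proof. by rewrite -(scale0r 0) dotvZl mul0r. Qed.

Lemma dotv0 m (v : 'cV[R]_m) : dotv v 0 = 0.
Proof. by rewrite dotvC dot0v. Qed.

Lemma dotv_sumr m (I : Type) (r : seq I) (F : I -> 'cV[R]_m) (v : 'cV[R]_m) :
  dotv v (\sum_(i <- r) F i) = \sum_(i <- r) dotv v (F i).
Proof.
by apply: (big_morph (dotv v)) => [a b|]; rewrite ?dotvDr ?dotv0.
Qed.

Lemma dotv_delta m (v : 'cV[R]_m) i : dotv v (delta_mx i 0) = v i 0.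
Proof.
rewrite /dotv (bigD1 i)//= mxE !eqxx mulr1 big1 ?addr0// => j ji.
by rewrite mxE (negbTE ji) mulr0.
Qed.

Lemma dotv_adjoint n d (A : 'M[R]_(n, d)) u v :
  dotv (A *m u) v = dotv u (A^T *m v).
Proof.
rewrite /dotv.
under eq_bigr do rewrite mxE mulr_suml.
rewrite exchange_big; apply: eq_bigr => j _.
rewrite mxE mulr_sumr; apply: eq_bigr => i _.
by rewrite mxE; ring.
Qed.

Lemma dotv_ge0 m (u : 'cV[R]_m) : 0 <= dotv u u.
Proof. by apply: sumr_ge0 => i _; rewrite -expr2 sqr_ge0. Qed.

Lemma dotvv_eq0 m (u : 'cV[R]_m) : (dotv u u == 0) = (u == 0).
Proof.
apply/idP/eqP => [|->]; last by rewrite dot0v.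
rewrite psumr_eq0 => [|i _]; last by rewrite -expr2 sqr_ge0.
move=> /allP u0; apply/colP => i; rewrite mxE; apply/eqP.
by have := u0 i (mem_index_enum i); rewrite /= mulf_eq0 orbb.
Qed.

Lemma enorm_ge0 m (u : 'cV[R]_m) : 0 <= enorm u.
Proof. exact: sqrtr_ge0. Qed.

Lemma enorm_sqr m (u : 'cV[R]_m) : enorm u ^+ 2 = dotv u u.
Proof. by rewrite sqr_sqrtr// dotv_ge0. Qed.

Lemma enormZ m a (u : 'cV[R]_m) : enorm (a *: u) = `|a| * enorm u.
Proof. by rewrite /enorm dotvZl dotvZr mulrA -expr2 sqrtrM ?sqr_ge0// sqrtr_sqr. Qed.

Lemma enormN m (u : 'cV[R]_m) : enorm (- u) = enorm u.
Proof. by rewrite /enorm dotvNl dotvNr opprK. Qed.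

Lemma enormBC m (u v : 'cV[R]_m) : enorm (u - v) = enorm (v - u).
Proof. by rewrite -enormN opprB. Qed.

Lemma enorm_eq0 m (u : 'cV[R]_m) : (enorm u == 0) = (u == 0).
Proof. by rewrite -(@sqrf_eq0 _ (enorm u)) enorm_sqr dotvv_eq0. Qed.

Lemma dotv_le m (u v : 'cV[R]_m) : dotv u v <= enorm u * enorm v.
Proof.
have [/eqP|u0] := eqVneq (enorm u) 0.
  by rewrite enorm_eq0 => /eqP ->; rewrite dot0v mulr_ge0 ?enorm_ge0.
have [/eqP|v0] := eqVneq (enorm v) 0.
  by rewrite enorm_eq0 => /eqP ->; rewrite dotv0 mulr_ge0 ?enorm_ge0.
have up : 0 < enorm u by rewrite lt0r u0 enorm_ge0.
have vp : 0 < enorm v by rewrite lt0r v0 enorm_ge0.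
have := dotv_ge0 (enorm v *: u - enorm u *: v).
rewrite dotvBl !dotvBr !dotvZl !dotvZr -!enorm_sqr (dotvC v u).
set a := enorm u; set b := enorm v; set c := dotv u v => H.
have : 0 <= (2 * a * b) * (a * b - c) by lra.
by rewrite pmulr_rge0 ?subr_ge0// !mulr_gt0.
Qed.

Lemma enormD_le m (u v : 'cV[R]_m) : enorm (u + v) <= enorm u + enorm v.
Proof.
rewrite -(@ler_sqr _ (enorm (u + v))) ?nnegrE ?addr_ge0 ?enorm_ge0//.
rewrite enorm_sqr dotvDl !dotvDr (dotvC v u) sqrrD !enorm_sqr.
have := dotv_le u v; lra.
Qed.

Lemma weighted_sum_dotvD (I : finType) (p : I -> R) m (a : 'cV[R]_m)
    (v : I -> 'cV[R]_m) : \sum_i p i = 1 ->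
  \sum_i p i * dotv (a + v i) (a + v i) =
  dotv a a + 2 * dotv a (\sum_i p i *: v i) + \sum_i p i * dotv (v i) (v i).
Proof.
move=> p1; have -> : dotv a a = \sum_i p i * dotv a a by rewrite -mulr_suml p1 mul1r.
rewrite dotv_sumr mulr_sumr -!big_split.
apply: eq_bigr => i _ /=.
by rewrite dotvDl !dotvDr dotvZr (dotvC (v i) a); ring.
Qed.

End Euclidean.

(** * Extended-real convex functions, minimisers and conjugates *)

Section ConvexAnalysis.
Context {R : realType}.

(** This is the limit [t -> 0]; if [a > c], a [t] making [t * q] at most half of the excess gives
    the contradiction. *)
Lemma ler_of_vanishing (a c q : R) :
  (forall t, 0 < t <= 1 -> a <= c + t * q) -> a <= c.
Proof.
move=> H; rewrite leNgt; apply/negP => ca.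
have [q0|q0] := leP q 0; first by have := H 1; rewrite ltr01 lexx => /(_ isT); lra.
pose t := Num.min 1 ((a - c) / (2 * q)).
have t01 : 0 < t <= 1.
  by rewrite /t lt_min ltr01 ge_min lexx /= divr_gt0 ?subr_gt0 ?mulr_gt0.
have : t * q <= (a - c) / 2.
  apply: (@le_trans _ _ ((a - c) / (2 * q) * q)).
    by rewrite ler_pM2r// /t ge_min lexx orbT.
  by rewrite invfM mulrA mulfVK ?gt_eqF.
by have := H t t01; lra.
Qed.

Lemma econvex_le (V : lmodType R) (f : V -> \bar R) (x y : V) (a b t : R) :
  econvex f -> 0 <= t <= 1 -> (f x <= a%:E)%E -> (f y <= b%:E)%E ->
  (f (t *: x + (1 - t) *: y)%R <= (t * a + (1 - t) * b)%:E)%E.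
Proof.
move=> fc t01 fx fy; have /andP[t0 t1] := t01.
apply: le_trans (fc x y t t01) _; rewrite (EFinD (t * a)) !EFinM.
by apply: leeD; apply: lee_wpmul2l; rewrite ?lee_fin ?subr_ge0.
Qed.

(** First-order optimality without derivatives: on the segment from [u] to [v], [f] lies below its
    chord and [Q] is a quadratic polynomial in [t], so comparing with the minimum, dividing by [t]
    and letting [t] vanish leaves only the slope [l]. *)
Lemma argmin_variational (V : lmodType R) (f : V -> \bar R) (Q : V -> R)
    (u v : V) (a b l q : R) :
  econvex f -> (f u = a%:E)%E -> (f v = b%:E)%E ->
  (forall t, Q (t *: v + (1 - t) *: u) = Q u + t * l + t ^+ 2 * q) ->
  argmin (fun u => f u + (Q u)%:E)%E u -> a <= b + l.
Proof.
move=> fc fu fv QE um; apply: (@ler_of_vanishing _ _ q) => t /andP[t0 t1].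
have t01 : 0 <= t <= 1 by rewrite ltW.
have := um (t *: v + (1 - t) *: u); rewrite fu => H.
have /(le_trans H) : (f (t *: v + (1 - t) *: u)%R + (Q (t *: v + (1 - t) *: u))%:E
    <= (t * b + (1 - t) * a + (Q u + t * l + t ^+ 2 * q))%:E)%E.
  by rewrite EFinD QE leeD2r// econvex_le// ?fu ?fv lexx.
rewrite -EFinD lee_fin => {}H.
have : t * a <= t * (b + l + t * q) by lra.
by rewrite ler_pM2l.
Qed.

Lemma econvex_mean (V : lmodType R) (f : V -> \bar R) (v : nat -> V)
    (a : nat -> R) (K : nat) : econvex f -> (forall k, (f (v k) <= (a k)%:E)%E) ->
  (0 < K)%N ->
  (f (K%:R^-1 *: \sum_(k < K) v k)%R <= (K%:R^-1 * \sum_(k < K) a k)%:E)%E.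
Proof.
move=> fc fa; elim: K => // -[_ _|K IH _].
  by rewrite !big_ord1 invr1 scale1r mul1r.
rewrite !(big_ord_recr K.+1) /=.
set s := \sum_(i < K.+1) v i in IH *; set b := \sum_(i < K.+1) a i in IH *.
set c : R := K.+1%:R in IH *.
have c0 : 0 < c by rewrite ltr0n.
have cS : K.+2%:R = c + 1 :> R by rewrite -natr1.
have c1 : c + 1 != 0 by rewrite gt_eqF// ltr_wpDr.
rewrite cS; clearbody c.
have -> : (c + 1)^-1 *: (s + v K.+1) =
    (c / (c + 1)) *: (c^-1 *: s) + (1 - c / (c + 1)) *: v K.+1.
  by rewrite scalerDr scalerA; congr (_ *: _ + _ *: _); field; rewrite ?c1 ?gt_eqF.
have -> : (c + 1)^-1 * (b + a K.+1) =
    c / (c + 1) * (c^-1 * b) + (1 - c / (c + 1)) * a K.+1.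
  by field; rewrite ?c1 ?gt_eqF.
apply: econvex_le => //; last exact: IH.
by rewrite divr_ge0 ?ltW ?ltr_wpDr//= ltr_pdivrMr ?mul1r ?ltrDl ?ltr_wpDr.
Qed.

Lemma fenchel_young (f : R -> \bar R) (z u : R) : f u \is a fin_num ->
  ((z * u - fine (f u))%:E <= conjugate f z)%E.
Proof.
by move=> fu; apply: ereal_sup_ubound; exists u => //; rewrite EFinB fineK.
Qed.

(** Equality case of Fenchel-Young: the affine minorant of slope [c] touching [f] at [u] bounds
    every term of the supremum. It is what makes [h] explicit at subgradients. *)
Lemma conjugate_subgradient (f : R -> \bar R) (u c : R) :
  f u \is a fin_num ->
  (forall v, ((fine (f u) + c * (v - u))%:E <= f v)%E) ->
  conjugate f c = (c * u - fine (f u))%:E.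
Proof.
move=> fu H; apply/eqP; rewrite eq_le fenchel_young// andbT.
apply: ge_ereal_sup => _ [v _ <-]; have := H v.
case: (f v) => [b||]//=; last by rewrite leNye.
by rewrite -EFinB !lee_fin; lra.
Qed.

Lemma conjugate_convex (f : R -> \bar R) : (forall v, f v != -oo%E) ->
  econvex (V := R^o) (conjugate f).
Proof.
move=> fN x y t /andP[t0 t1]; apply: ge_ereal_sup => _ [v _ <-].
have := fN v; case fv: (f v) => [b||]//= _; last by rewrite leNye.
have fvb : f v \is a fin_num by rewrite fv.
have := fenchel_young x fvb; have := fenchel_young y fvb; rewrite fv /= => Hy Hx.
have -> : (((t *: x + (1 - t) *: y : R^o) * v)%R%:E - b%:E)%E =
    (t%:E * (x * v - b)%:E + (1 - t)%:E * (y * v - b)%:E)%E :> \bar R.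
  rewrite -!EFinM -!EFinD; congr EFin.
  by rewrite /GRing.scale /=; ring.
by apply: leeD; apply: lee_wpmul2l; rewrite ?lee_fin ?subr_ge0.
Qed.

End ConvexAnalysis.

(** * Separable functions and their conjugates, coordinate by coordinate *)

Section Separable.
Context {R : realType} {n : nat} (hs : 'I_n -> R -> \bar R).
Let hstar := separable_sum hs.
Let h := separable_sum (fun i => conjugate (hs i)).

Lemma separable_sum_gtNy (y : 'cV[R]_n) : (forall i t, hs i t != -oo%E) ->
  (hstar y < +oo)%E -> forall i, hs i (y i 0) \is a fin_num.
Proof.
move=> hN hy i; rewrite fin_numE hN /=; apply/eqP => hi.
move: hy; rewrite /hstar /separable_sum.
suff -> : (\sum_(j < n) hs j (y j 0%R))%E = +oo%E by [].
by apply/eqP; rewrite esum_eqy => [|j _]; [apply/existsP; exists i; rewrite hi eqxx|].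
Qed.

(** In [\bar R] the value -oo absorbs even +oo under addition, so one such coordinate spoils the sum
    at the constant vector. *)
Lemma separable_coord_neqNy (i : 'I_n) (t : R) :
  (forall y, hstar y != -oo%E) -> hs i t != -oo%E.
Proof.
move=> hN; apply: contra (hN (const_mx t)) => /eqP hi.
rewrite /hstar /separable_sum esum_eqNy; apply/existsP; exists i; rewrite /=.
by rewrite mxE hi eqxx.
Qed.

Lemma separable_sum_update (y : 'cV[R]_n) i t :
  (hstar (y + (t - y i 0%R) *: delta_mx i 0)%R =
   hs i t + \sum_(j < n | j != i) hs j (y j 0%R))%E.
Proof.
rewrite /hstar /separable_sum (bigD1 i)//=; congr (_ + _)%E.
  by rewrite !mxE !eqxx mulr1 addrC subrK.
by apply: eq_bigr => j ji; rewrite !mxE (negbTE ji) mulr0 addr0.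
Qed.

(** Convexity is restricted to the line through a domain point [y] in direction [i]; the other
    summands are finite there and cancel. *)
Lemma separable_coord_convex (i : 'I_n) :
  eproper hstar -> econvex hstar -> econvex (V := R^o) (hs i).
Proof.
move=> [hN [y hy]] hc a b t t01.
have hN' j s : hs j s != -oo%E by exact: separable_coord_neqNy.
have yfin := separable_sum_gtNy hN' hy.
pose upd s := y + (s - y i 0) *: delta_mx i 0.
have rfin : (\sum_(j < n | j != i) hs j (y j 0%R))%E \is a fin_num.
  by apply/sum_fin_numP => j _ _.
have := hc (upd a) (upd b) t t01.
have -> : t *: upd a + (1 - t) *: upd b = upd (t *: (a : R^o) + (1 - t) *: (b : R^o)).
  by apply/colP => j; rewrite !mxE /GRing.scale /=; ring.
rewrite !separable_sum_update; move: rfin; set r := (\sum_(_ < _ | _) _)%E.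
case: r => // r _; have /andP[t0 t1] := t01.
(* The endpoints are separate because [0 * +oo = 0]; for [0 < t < 1] an infinite endpoint value
   makes the right-hand side +oo. *)
have [->|tn0] := eqVneq t 0.
  by rewrite subr0 scale1r scale0r add0r !mul0e !mul1e !add0e.
have [->|tn1] := eqVneq t 1.
  by rewrite subrr scale1r scale0r addr0 !mul0e !mul1e !adde0.
have tp : 0 < t by rewrite lt0r tn0.
have tp' : 0 < 1 - t by rewrite subr_gt0 lt_neqAle tn1.
have := hN' i a; have := hN' i b.
case: (hs i b) => [fb||]//=; case: (hs i a) => [fa||]//= _ _ H.
- move: H; case: (hs i _) => [f||]//=; rewrite ?leNye// -!EFinM -!EFinD ?lee_fin//.
  lra.
- by rewrite gt0_muley ?lte_fin// addye ?leey// -EFinM.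
- by rewrite [X in (_ <= _ + X)%E]gt0_muley ?lte_fin// addey ?leey// -EFinM.
- by rewrite !gt0_muley ?lte_fin// addye ?leey.
Qed.

Definition fine_sum (y : 'cV[R]_n) : R := \sum_(i < n) fine (hs i (y i 0)).

Lemma separable_sumE (y : 'cV[R]_n) : (forall i, hs i (y i 0) \is a fin_num) ->
  hstar y = (fine_sum y)%:E.
Proof.
by move=> yf; rewrite -sumEFin; apply: eq_bigr => i _; rewrite fineK.
Qed.

Lemma dotvB_fine_sum (z y : 'cV[R]_n) :
  dotv z y - fine_sum y = \sum_(i < n) (z i 0 * y i 0 - fine (hs i (y i 0))).
Proof. by rewrite /dotv /fine_sum -sumrB. Qed.

Lemma separable_fenchel_young (z y : 'cV[R]_n) :
  (forall i, hs i (y i 0) \is a fin_num) ->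
  ((dotv z y - fine_sum y)%:E <= h z)%E.
Proof.
move=> yf; rewrite dotvB_fine_sum -sumEFin; apply: lee_sum => i _.
exact: fenchel_young.
Qed.

Lemma separable_conjugate_subgradient (c y : 'cV[R]_n) :
  (forall i, hs i (y i 0) \is a fin_num) ->
  (forall i v, ((fine (hs i (y i 0)) + c i 0 * (v - y i 0))%:E <= hs i v)%E) ->
  h c = (dotv c y - fine_sum y)%:E.
Proof.
move=> yf cy; rewrite dotvB_fine_sum -sumEFin; apply: eq_bigr => i _.
exact: conjugate_subgradient.
Qed.

Lemma separable_subgradient_monotone (c c' y y' : 'cV[R]_n) :
  (forall i, hs i (y i 0) \is a fin_num) ->
  (forall i v, ((fine (hs i (y i 0)) + c i 0 * (v - y i 0))%:E <= hs i v)%E) ->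
  (forall i, hs i (y' i 0) \is a fin_num) ->
  (forall i v, ((fine (hs i (y' i 0)) + c' i 0 * (v - y' i 0))%:E <= hs i v)%E) ->
  0 <= dotv (c - c') (y - y').
Proof.
move=> yf cy yf' cy'; apply: sumr_ge0 => i _; rewrite !mxE.
have := cy i (y' i 0); have := cy' i (y i 0).
rewrite -(fineK (yf i)) -(fineK (yf' i)) !lee_fin /=; lra.
Qed.

Lemma separable_conjugate_mean (c y : nat -> 'cV[R]_n) (K : nat) :
  (forall i t, hs i t != -oo%E) ->
  (forall k i, hs i (y k i 0) \is a fin_num) ->
  (forall k i v, ((fine (hs i (y k i 0)) + c k i 0 * (v - y k i 0))%:E
     <= hs i v)%E) ->
  (0 < K)%N ->
  (h (K%:R^-1 *: \sum_(k < K) c k)%R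
   <= (K%:R^-1 * \sum_(k < K) (dotv (c k) (y k) - fine_sum (y k)))%:E)%E.
Proof.
move=> hN yf cy K0.
rewrite (eq_bigr _ (fun (k : 'I_K) _ => dotvB_fine_sum (c k) (y k))).
rewrite exchange_big mulr_sumr -sumEFin; apply: lee_sum => i _.
rewrite mxE summxE.
apply: (@econvex_mean _ R^o (conjugate (hs i)) (fun k => c k i 0)
  (fun k => c k i 0 * y k i 0 - fine (hs i (y k i 0)))) => //.
  exact: conjugate_convex.
by move=> k; rewrite (conjugate_subgradient (yf k i) (cy k i)).
Qed.

End Separable.

(** * Finiteness and optimality conditions at a saddle point *)

Section Saddle.
Context {R : realType} {n d : nat} (A : 'M[R]_(n, d)) (g : 'cV[R]_d -> \bar R)
  (hs : 'I_n -> R -> \bar R) (xs : 'cV[R]_d) (ys : 'cV[R]_n).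
Hypotheses (g_proper : eproper g) (hstar_proper : eproper (separable_sum hs))
  (saddle : saddle_point (lagrangian A g (separable_sum hs)) xs ys).

Let hsN i t : hs i t != -oo%E.
Proof. by apply: separable_coord_neqNy; case: hstar_proper. Qed.

(** An infinite dual value at [ys] would make the Lagrangian -oo there, whatever [g xs] is, while at
    a domain point [y0] it exceeds -oo. *)
Lemma saddle_point_dual_fin i : hs i (ys i 0) \is a fin_num.
Proof.
apply: separable_sum_gtNy => //; rewrite ltey; apply/eqP => hy.
have [_ [y0 y0f]] := hstar_proper.
have y0N : separable_sum hs y0 != -oo%E by case: hstar_proper.
have := saddle.2 y0; rewrite /lagrangian hy.
have := g_proper.1 xs.
by case: (g xs) y0f y0N => [a||]//; case: (separable_sum hs y0).
Qed.

Let hysE : separable_sum hs ys = (fine_sum hs ys)%:E.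
Proof. exact/separable_sumE/saddle_point_dual_fin. Qed.

Lemma saddle_point_primal_fin : g xs \is a fin_num.
Proof.
have [_ [x0 x0f]] := g_proper; have x0N := g_proper.1 x0.
have := saddle.1 x0; rewrite /lagrangian hysE.
by have := g_proper.1 xs; case: (g xs) => [a||]//; case: (g x0) x0f x0N.
Qed.

Lemma saddle_point_primal x : g x \is a fin_num ->
  fine (g xs) + dotv (A *m xs) ys <= fine (g x) + dotv (A *m x) ys.
Proof.
move=> gx; have := saddle.1 x; rewrite /lagrangian hysE.
rewrite -(fineK gx) -(fineK saddle_point_primal_fin) -!EFinB -!EFinD lee_fin /=.
lra.
Qed.

(** Changing [ys] in coordinate [i] alone cancels all other summands, so maximality in [y] places
    [A *m xs] in the subdifferential coordinatewise. *)
Lemma saddle_point_dual i v :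
  ((fine (hs i (ys i 0)) + (A *m xs) i 0 * (v - ys i 0))%:E <= hs i v)%E.
Proof.
have := saddle.2 (ys + (v - ys i 0) *: delta_mx i 0).
rewrite /lagrangian separable_sum_update hysE dotvDr dotvZr dotv_delta.
have yf := saddle_point_dual_fin.
have -> : (\sum_(j < n | j != i) hs j (ys j 0%R) =
    (fine_sum hs ys - fine (hs i (ys i 0%R)))%:E)%E.
  rewrite /fine_sum [in RHS](bigD1 i)//= addrAC subrr add0r -sumEFin.
  by apply: eq_bigr => j _; rewrite fineK.
rewrite -(fineK saddle_point_primal_fin); have := hsN i v.
case: (hs i v) => [b||]//= _; last by rewrite leey.
rewrite -!EFinD !lee_fin; lra.
Qed.

End Saddle.

(** * Words of drawn indices and finite expectations over them *)

Section Histories.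
Context {R : realType} {n : nat}.

Definition history (Omega : Type) (idx : nat -> Omega -> 'I_n) (k : nat)
  (w : Omega) : seq 'I_n := [seq idx l w | l <- iota 0 k].

Lemma historyS (Omega : Type) (idx : nat -> Omega -> 'I_n) k w :
  history idx k.+1 w = rcons (history idx k w) (idx k w).
Proof. by rewrite /history -addn1 iotaD map_cat cats1. Qed.

Lemma size_history (Omega : Type) (idx : nat -> Omega -> 'I_n) k w :
  size (history idx k w) = k.
Proof. by rewrite size_map size_iota. Qed.

Lemma take_history (Omega : Type) (idx : nat -> Omega -> 'I_n) k l w :
  (l <= k)%N -> take l (history idx k w) = history idx l w.
Proof. by move=> lk; rewrite -map_take take_iota (minn_idPl lk). Qed.

Fixpoint histories (k : nat) : seq (seq 'I_n) :=
  if k is k'.+1 then [seq rcons s i | s <- histories k', i <- index_enum 'I_n]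
  else [:: [::]].

Definition path_weight (p : 'I_n -> R) (s : seq 'I_n) : R := \prod_(i <- s) p i.

(** Expectation over words of [k] independent letters of law [p]. The convergence argument is
    carried out entirely with it, and [integral_history] links it to [P]. *)
Definition path_mean (p : 'I_n -> R) (k : nat) (f : seq 'I_n -> R) : R :=
  \sum_(s <- histories k) path_weight p s * f s.

Section PathMean.
Context (p : 'I_n -> R).
Hypotheses (p_ge0 : forall i, 0 <= p i) (p_sum : \sum_i p i = 1).

Lemma path_mean0 f : path_mean p 0 f = f [::].
Proof. by rewrite /path_mean big_seq1 /path_weight big_nil mul1r. Qed.

Lemma path_meanS k f :
  path_mean p k.+1 f = path_mean p k (fun s => \sum_i p i * f (rcons s i)).
Proof.
rewrite /path_mean /= big_allpairs_dep; apply: eq_bigr => s _.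
rewrite mulr_sumr; apply: eq_bigr => i _.
by rewrite /path_weight big_rcons /=; ring.
Qed.

Lemma path_mean_le k f f' : (forall s, size s = k -> f s <= f' s) ->
  path_mean p k f <= path_mean p k f'.
Proof.
elim: k f f' => [|k IH] f f' ff'; first by rewrite !path_mean0 ff'.
rewrite !path_meanS; apply: IH => s sk; apply: ler_sum => i _.
by rewrite ler_wpM2l// ff'// size_rcons sk.
Qed.

Lemma path_meanD k f f' :
  path_mean p k (fun s => f s + f' s) = path_mean p k f + path_mean p k f'.
Proof. by rewrite -big_split; apply: eq_bigr => s _; rewrite mulrDr. Qed.

Lemma path_meanZ k c f : path_mean p k (fun s => c * f s) = c * path_mean p k f.
Proof. by rewrite mulr_sumr; apply: eq_bigr => s _; rewrite mulrCA. Qed.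

Lemma path_mean_cst k c : path_mean p k (fun=> c) = c.
Proof.
elim: k => [|k IH]; first by rewrite path_mean0.
by rewrite path_meanS -mulr_suml p_sum mul1r.
Qed.

Lemma path_mean_supermartingale k f :
  (forall s, \sum_i p i * f (rcons s i) <= f s) -> path_mean p k f <= f [::].
Proof.
move=> H; elim: k => [|k IH]; first by rewrite path_mean0.
by rewrite path_meanS; apply: le_trans IH; apply: path_mean_le => s _.
Qed.

(** The variance is nonnegative, hence the squared mean is at most the mean square. *)
Lemma path_mean_sqr_le k f c : 0 <= c ->
  path_mean p k (fun s => f s ^+ 2) <= c ^+ 2 -> path_mean p k f <= c.
Proof.
move=> c0 fc; set m := path_mean p k f.
have : 0 <= path_mean p k (fun s => (f s - m) ^+ 2).
  by rewrite -[leLHS](path_mean_cst k); apply: path_mean_le => s _; exact: sqr_ge0.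
have -> : path_mean p k (fun s => (f s - m) ^+ 2) =
    path_mean p k (fun s => f s ^+ 2) - m ^+ 2.
  transitivity (path_mean p k (fun s => f s ^+ 2 + ((- 2 * m) * f s + m ^+ 2))).
    by congr (path_mean p k _); apply/funext => s; ring.
  rewrite path_meanD path_meanD path_meanZ path_mean_cst -/m; ring.
have [m0|m0] := leP m 0; first by move=> _; exact: le_trans c0.
by move=> H; rewrite -ler_sqr ?nnegrE ?(ltW m0)//; lra.
Qed.

End PathMean.

(** * Law of the history under [P], and integrals of functions of the history *)

Section Probability.
Context (disp : measure_display) (Omega : measurableType disp)
  (P : probability Omega R) (p : 'I_n -> R) (idx : nat -> Omega -> 'I_n).
Hypothesis idx_random : random_indices P p idx.

Lemma history_rcons_set k s i :
  [set w | history idx k.+1 w = rcons s i] =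
  [set w | history idx k w = s] `&` [set w | idx k w = i].
Proof.
apply/seteqP; split=> w /=; rewrite historyS; first by move=> /rcons_inj [-> ->].
by move=> [-> ->].
Qed.

Lemma measurable_history k s : measurable [set w | history idx k w = s].
Proof.
elim/last_ind: s k => [|s i IH] [|k].
- by rewrite (_ : [set _ | _] = setT)//; apply/seteqP.
- rewrite (_ : [set _ | _] = set0)//; apply/seteqP; split=> //.
- rewrite (_ : [set _ | _] = set0)//; apply/seteqP; split=> // w /=.
  by move=> /(congr1 size); rewrite size_rcons.
- rewrite history_rcons_set; apply: measurableI; first exact: IH.
  by case: idx_random.
Qed.

Lemma history_probability s :
  P [set w | history idx (size s) w = s] = (path_weight p s)%:E.
Proof.
elim/last_ind: s => [|s i IH].
  rewrite /path_weight big_nil (_ : [set _ | _] = setT) ?probability_setT//.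
  exact/seteqP.
rewrite size_rcons history_rcons_set.
have [_ pE indep] := idx_random.
have := indep (size s) [set t | tval t = s] i.
rewrite (_ : [set w | _] = [set w | history idx (size s) w = s]).
  move=> ->; rewrite IH [X in (_ * X)%E]pE -EFinM.
  by rewrite /path_weight big_rcons.
apply/seteqP; split=> w /=;
  by rewrite /history -val_enum_ord -map_comp.
Qed.

(** An event of positive probability is nonempty. The sample points obtained here serve to read off
    the iterates after any word. *)
Lemma history_witness s : (forall i, 0 < p i) ->
  exists w, history idx (size s) w = s.
Proof.
move=> p0; apply/not_existsP => H.
have := history_probability s; rewrite (_ : [set _ | _] = set0); last first.
  by apply/seteqP; split=> // w /= /H.
move=> /eqP; rewrite measure0 eqe eq_sym /path_weight.
by rewrite prodf_seq_eq0 => /hasP[i _] /=; rewrite gt_eqF.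
Qed.

(** A function of the history is a finite combination of indicators of measurable events; this
    settles measurability and integrability together. *)
Lemma histories_decomposition k (f : seq 'I_n -> R) w :
  f (history idx k w) =
  \sum_(s <- histories k) f s * \1_[set w | history idx k w = s] w.
Proof.
elim: k f => [|k IH] f.
  by rewrite /= big_seq1 indicE mem_set// mulr1.
rewrite historyS (IH (fun s => f (rcons s (idx k w)))) /= big_allpairs_dep.
apply: eq_bigr => s _; rewrite [RHS](bigD1 (idx k w))//= big1 ?addr0 => [|i ik].
  by rewrite history_rcons_set indicI/= [X in _ = _ * (_ * X)]indicE mem_set// mulr1.
rewrite history_rcons_set indicI/= [X in _ * (_ * X)]indicE memNset ?mulr0//.
by move=> /= E; rewrite E eqxx in ik.
Qed.

Lemma size_histories k s : s \in histories k -> size s = k.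
Proof.
elim: k s => [|k IH] s; first by rewrite inE => /eqP ->.
by move=> /allpairsPdep[s' [i [/IH <- _ ->]]]; rewrite size_rcons.
Qed.

Lemma integral_history k f :
  (\int[P]_w (f (history idx k w))%:E = (path_mean p k f)%:E)%E.
Proof.
under eq_integral do rewrite histories_decomposition -sumEFin.
have indic_int s : P.-integrable [set: Omega]
    (fun w => (\1_[set w | history idx k w = s] w)%:E).
  by apply: integrable_indic; exact: measurable_history.
rewrite integral_sum//; last first.
  by move=> s; under eq_fun do rewrite EFinM; exact: integrableZl.
rewrite /path_mean -sumEFin !big_seq; apply: eq_bigr => s sk.
under eq_integral do rewrite EFinM.
rewrite integralZl// integral_indic// ?setIT; last exact: measurable_history.
rewrite [RHS]EFinM muleC; congr (_ * _)%E.
by rewrite -(size_histories sk); exact: history_probability.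
Qed.

End Probability.
End Histories.

(** * Optimality and uniqueness of proximal points *)

Section Prox.
Context {R : realType}.

Lemma argmin_fin (V : Type) (f : V -> \bar R) (Q : V -> R) u :
  eproper f -> argmin (fun u => f u + (Q u)%:E)%E u -> f u \is a fin_num.
Proof.
move=> [fN [v fv]] /(_ v); have := fN u; have := fN v.
by case: (f v) fv => [b||]//; case: (f u).
Qed.

Lemma prox_scalar_variational m (f : 'cV[R]_m -> \bar R) t x u v :
  eproper f -> econvex f -> t != 0 -> prox t%:M f x u -> f v \is a fin_num ->
  fine (f u) + t^-1 * dotv (x - u) (v - u) <= fine (f v).
Proof.
move=> fp fc t0 up fv; have fu := argmin_fin fp up.
have wE w : wnorm2 (invmx t%:M) w = t^-1 * dotv w w.
  by rewrite /wnorm2 invmx_scalar mul_scalar_mx dotvZr.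
have := @argmin_variational _ _ f (fun u => 2^-1 * wnorm2 (invmx t%:M) (u - x))
  u v _ _ (t^-1 * dotv (u - x) (v - u)) (2^-1 * (t^-1 * dotv (v - u) (v - u)))
  fc (esym (fineK fu)) (esym (fineK fv)).
rewrite -[x - u]opprB dotvNl => H; suff : fine (f u) <= fine (f v)
   + t^-1 * dotv (u - x) (v - u) by lra.
apply: H => // s; rewrite !wE.
have -> : s *: v + (1 - s) *: u - x = (u - x) + s *: (v - u).
  by apply/colP => i; rewrite !mxE; ring.
rewrite (dotvDl (u - x)) !(dotvDr (u - x)) !dotvZl !dotvZr (dotvC (v - u) (u - x)).
by field.
Qed.

(** Testing each minimiser's variational inequality at the other and adding gives
    [dotv (u - v) (u - v) <= 0]. *)
Lemma prox_scalar_unique m (f : 'cV[R]_m -> \bar R) t x u v :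
  eproper f -> econvex f -> 0 < t -> prox t%:M f x u -> prox t%:M f x v -> u = v.
Proof.
move=> fp fc t0 up vp.
have tn0 : t != 0 by rewrite gt_eqF.
have := prox_scalar_variational fp fc tn0 up (argmin_fin fp vp).
have := prox_scalar_variational fp fc tn0 vp (argmin_fin fp up).
move=> H1 H2; apply/eqP; rewrite -subr_eq0 -dotvv_eq0 eq_le dotv_ge0 andbT.
rewrite -(pmulr_rle0 _ (_ : 0 < t^-1)) ?invr_gt0//.
have -> : dotv (u - v) (u - v) = dotv (x - u) (v - u) + dotv (x - v) (u - v).
  by rewrite -[v - u]opprB dotvNr -dotvNl -dotvDl; congr dotv;
    apply/colP => i; rewrite !mxE; ring.
rewrite mulrDr; lra.
Qed.

Lemma sprox_subgradient (f : R -> \bar R) s z u :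
  eproper f -> econvex (V := R^o) f -> s != 0 -> sprox s f z u ->
  forall v, ((fine (f u) + s^-1 * (z - u) * (v - u))%:E <= f v)%E.
Proof.
move=> fp fc s0 up v; have fu := argmin_fin fp up.
have := fp.1 v; case fvE : (f v) => [b||]// _; last by rewrite leey.
have := @argmin_variational _ R^o f (fun u => 2^-1 * (s^-1 * (u - z) ^+ 2))
  u v _ _ (s^-1 * (u - z) * (v - u)) (2^-1 * (s^-1 * (v - u) ^+ 2))
  fc (esym (fineK fu)) fvE.
move=> H; rewrite lee_fin; suff : fine (f u) <= b + s^-1 * (u - z) * (v - u) by lra.
by apply: H => // t; rewrite /GRing.scale /=; field.
Qed.

Lemma sprox_unique (f : R -> \bar R) s z u v :
  eproper f -> econvex (V := R^o) f -> 0 < s -> sprox s f z u -> sprox s f z v ->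
  u = v.
Proof.
move=> fp fc s0 up vp; have sn0 : s != 0 by rewrite gt_eqF.
have := sprox_subgradient fp fc sn0 up v.
have := sprox_subgradient fp fc sn0 vp u.
rewrite -(fineK (argmin_fin fp up)) -(fineK (argmin_fin fp vp)) !lee_fin /=.
move=> H1 H2; apply/eqP; rewrite -subr_eq0 -sqrf_eq0 eq_le sqr_ge0 andbT.
rewrite -(pmulr_rle0 _ (_ : 0 < s^-1)) ?invr_gt0//; lra.
Qed.

End Prox.

(** * From runs on a probability space to runs indexed by words *)

Section Run.
Context {R : realType} {n d : nat} (A : 'M[R]_(n, d))
  (g : 'cV[R]_d -> \bar R) (hs : 'I_n -> R -> \bar R)
  (tau : R) (sigma p : 'I_n -> R) (x0 : 'cV[R]_d) (y0 : 'cV[R]_n).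

(* The iterates after a history [s] of drawn indices, with [D s] the increment
   of the full dual step, of which only the drawn coordinate is performed. *)
Record history_run (X Xb : seq 'I_n -> 'cV[R]_d) (Y D : seq 'I_n -> 'cV[R]_n) :
    Prop := HistoryRun {
  run_x0 : X [::] = x0;
  run_y0 : Y [::] = y0;
  run_prox s : prox tau%:M g (X s - tau *: (A^T *m Y s)) (Xb s);
  run_sprox s i : sprox (sigma i) (hs i)
    (Y s i 0 + sigma i * (A *m Xb s) i 0) ((Y s + D s) i 0);
  run_x s i : X (rcons s i) = Xb s - (tau / p i * D s i 0) *: (row i A)^T;
  run_y s i : Y (rcons s i) = Y s + D s i 0 *: delta_mx i 0 }.

Hypotheses (g_proper : eproper g) (g_convex : econvex g)
  (hs_proper : forall i, eproper (hs i))
  (hs_convex : forall i, econvex (V := R^o) (hs i))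
  (tau_gt0 : 0 < tau) (sigma_gt0 : forall i, 0 < sigma i)
  (p_gt0 : forall i, 0 < p i).

(** By induction, equal histories give equal iterates, since each proximal point is unique. One
    chosen sample point [W s] per word therefore determines the iterates for all sample points with
    that history. *)
Lemma history_runP (Omega : Type) (idx : nat -> Omega -> 'I_n)
    (x xbar : nat -> Omega -> 'cV[R]_d) (y : nat -> Omega -> 'cV[R]_n) :
  (forall s, exists w, history idx (size s) w = s) ->
  (forall w, pure_cd A g hs (fun=> tau%:M) (fun=> diag_mx (\row_i sigma i))
     (fun=> 1%:M) p x0 y0 (idx^~ w) (x^~ w) (xbar^~ w) (y^~ w)) ->
  exists X Xb Y D, history_run X Xb Y D /\
    forall k w, xbar k.+1 w = Xb (history idx k w).
Proof.
move=> /choice[W WP] run.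
have runx w k : prox tau%:M g (x k w - tau *: (A^T *m y k w)) (xbar k.+1 w).
  by have [_ _ /(_ k)[+ _ _ _]] := run w; rewrite mul_scalar_mx scalemxAl.
have runy w k : sprox (sigma (idx k w)) (hs (idx k w))
    (y k w (idx k w) 0 + sigma (idx k w) * (A *m xbar k.+1 w) (idx k w) 0)
    (y k.+1 w (idx k w) 0).
  by have [_ _ /(_ k)[_ + _ _]] := run w; rewrite !mxE eqxx mulr1n.
have stepy w k : y k.+1 w =
    y k w + (y k.+1 w (idx k w) 0 - y k w (idx k w) 0) *: delta_mx (idx k w) 0.
  apply/colP => i; rewrite !mxE; have [->|ik] := eqVneq i (idx k w).
    by rewrite mulr1 addrC subrK.
  by have [_ _ /(_ k)[_ _ -> // _]] := run w; rewrite mulr0 addr0.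
have stepx w k : x k.+1 w = xbar k.+1 w - (tau / p (idx k w)
    * (y k.+1 w (idx k w) 0 - y k w (idx k w) 0)) *: (row (idx k w) A)^T.
  have [_ _ /(_ k)[_ _ _ ->]] := run w; congr (_ - _).
  rewrite {1}(stepy w k) [_ + _ - _]addrAC subrr add0r.
  set e := _ - _; set i := idx k w; set B := diag_mx _.
  have Bu : B \in unitmx.
    rewrite unitmxE det_diag unitfE prodf_seq_neq0; apply/allP => j _ /=.
    by rewrite mxE gt_eqF.
  (* The dual increment is exhibited in the image of [B], so that [invmx B] cancels without being
     computed. *)
  have -> : e *: delta_mx i 0 = B *m ((e / p i) *: delta_mx i 0) :> 'cV[R]_n.
    apply/colP => j; rewrite mul_diag_mx !mxE eqxx andbT.
    have [->|_] := eqVneq j i; last by rewrite !mulr0.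
    by rewrite !mulr1 mulrC divfK ?gt_eqF.
  rewrite -!mulmxA mulKmx// !mul_scalar_mx scale1r -scalemxAr -colE -tr_row scalerA.
  by congr (_ *: _); ring.
have det k w w' : history idx k w = history idx k w' ->
    x k w = x k w' /\ y k w = y k w'.
  elim: k w w' => [|k IH] w w'.
    by have [-> -> _] := run w; have [-> -> _] := run w'.
  rewrite !historyS => /rcons_inj[/IH[xE yE] iE].
  have xbE : xbar k.+1 w = xbar k.+1 w'.
    apply: (prox_scalar_unique g_proper g_convex tau_gt0 (runx w k)).
    by rewrite xE yE; exact: runx.
  have ykE : y k.+1 w (idx k w) 0 = y k.+1 w' (idx k w') 0.
    rewrite [in RHS]/= -iE.
    apply: (sprox_unique (hs_proper _) (hs_convex _) (sigma_gt0 _) (runy w k)).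
    by have := runy w' k; rewrite -iE -xbE -yE.
  by split; [rewrite !stepx xbE | rewrite (stepy w) (stepy w')]; rewrite ykE yE iE.
have detb k w w' : history idx k w = history idx k w' ->
    xbar k.+1 w = xbar k.+1 w'.
  move=> /det[xE yE].
  apply: (prox_scalar_unique g_proper g_convex tau_gt0 (runx w k)).
  by rewrite xE yE; exact: runx.
have Wrcons s i : history idx (size s) (W (rcons s i)) = s /\
    idx (size s) (W (rcons s i)) = i.
  by have := WP (rcons s i); rewrite size_rcons historyS => /rcons_inj[-> ->].
have Wx s i : x (size s) (W (rcons s i)) = x (size s) (W s) /\
    y (size s) (W (rcons s i)) = y (size s) (W s).
  by apply: det; rewrite WP; case: (Wrcons s i).
have Wb s i : xbar (size s).+1 (W (rcons s i)) = xbar (size s).+1 (W s).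
  by apply: detb; rewrite WP; case: (Wrcons s i).
(* A sample point performs the dual prox only at its drawn coordinate, so coordinate [i] of the full
   step is read at [W (rcons s i)], a different sample point for each [i]. *)
exists (fun s => x (size s) (W s)), (fun s => xbar (size s).+1 (W s)),
  (fun s => y (size s) (W s)),
  (fun s => \col_i (y (size s).+1 (W (rcons s i)) i 0 - y (size s) (W s) i 0)).
split; last first.
  move=> k w; rewrite size_history; apply: detb.
  by rewrite -{2}(size_history idx k w) WP.
split.
- by have [] := run (W [::]).
- by have [] := run (W [::]).
- by move=> s; exact: runx.
- move=> s i; have := runy (W (rcons s i)) (size s).
  have [_ ->] := Wrcons s i; have [_ ->] := Wx s i.
  by rewrite Wb !mxE addrC subrK.
- move=> s i; rewrite size_rcons stepx Wb mxE.
  by have [_ ->] := Wrcons s i; have [_ ->] := Wx s i.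
- move=> s i; rewrite size_rcons stepy mxE.
  by have [_ ->] := Wrcons s i; have [_ ->] := Wx s i.
Qed.

End Run.

Section PathSum.
Context {V : zmodType} {T : Type}.

(** Only proper prefixes enter, so each summand is fixed before the corresponding index is drawn, as
    in the compensator of a martingale. *)
Definition path_sum (f : seq T -> V) (s : seq T) : V :=
  \sum_(k < size s) f (take k s).

Lemma path_sum_nil f : path_sum f [::] = 0.
Proof. exact: big_ord0. Qed.

Lemma path_sum_rcons f s i : path_sum f (rcons s i) = path_sum f s + f s.
Proof.
rewrite /path_sum size_rcons big_ord_recr /= -cats1 take_size_cat//.
by congr (_ + _); apply: eq_bigr => k _; rewrite takel_cat// ltnW.
Qed.

End PathSum.

(** * The potential and its one-step decrease *)

Section Potential.
Context {R : realType} {n d : nat} (A : 'M[R]_(n, d))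
  (g : 'cV[R]_d -> \bar R) (hs : 'I_n -> R -> \bar R) (gamma : R).
Let S := \sum_(i < n) row_norm A i.
Let p := fun i : 'I_n => row_norm A i / S.
Let sigma := fun i : 'I_n => gamma / row_norm A i.
Let G := S / gamma.
Context (x0 : 'cV[R]_d) (y0 : 'cV[R]_n)
  (X Xb : seq 'I_n -> 'cV[R]_d) (Y D : seq 'I_n -> 'cV[R]_n).
Hypotheses (g_proper : eproper g) (g_convex : econvex g)
  (hs_proper : forall i, eproper (hs i))
  (hs_convex : forall i, econvex (V := R^o) (hs i))
  (rows_gt0 : forall i, 0 < row_norm A i) (S_gt0 : 0 < S)
  (gamma_gt0 : 0 < gamma) (gamma_lt1 : gamma < 1)
  (runXY : history_run A g hs S^-1 sigma p x0 y0 X Xb Y D).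

Let p_gt0 i : 0 < p i. Proof. exact: divr_gt0. Qed.
Let p_sum : \sum_i p i = 1.
Proof. by rewrite -mulr_suml divff// gt_eqF. Qed.

(** Conditional expectation of the dual step actually performed after [s]. *)
Definition mean_increment (s : seq 'I_n) : 'cV[R]_n := \col_i (p i * D s i 0).

Definition full_dual (s : seq 'I_n) : 'cV[R]_n := Y s + D s.

(* Since [1 / sigma i = G * p i], this is [A *m Xb s - Sigma^-1 *m D s], which
   the optimality condition of the dual prox places in the subdifferential of
   the separable dual function at [full_dual s]. *)
Definition dual_subgradient (s : seq 'I_n) : 'cV[R]_n :=
  A *m Xb s - G *: mean_increment s.

Lemma full_dual_fin s i : hs i (full_dual s i 0) \is a fin_num.
Proof. exact: argmin_fin (hs_proper i) (run_sprox runXY s i). Qed.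

Lemma primal_fin s : g (Xb s) \is a fin_num.
Proof. exact: argmin_fin g_proper (run_prox runXY s). Qed.

Lemma dual_subgradientP s i v :
  ((fine (hs i (full_dual s i 0)) +
    dual_subgradient s i 0 * (v - full_dual s i 0))%:E <= hs i v)%E.
Proof.
have ai := rows_gt0 i.
have sn0 : sigma i != 0 by rewrite gt_eqF// divr_gt0.
have := sprox_subgradient (hs_proper i) (hs_convex i) sn0 (run_sprox runXY s i) v.
rewrite -/(full_dual s); congr (((_ + _ * _)%:E <= _)%E).
rewrite /full_dual /dual_subgradient; move: (A *m Xb s) => w.
by rewrite !mxE /p /sigma /G; field; rewrite !gt_eqF.
Qed.

(** Compensator of the dual iterates minus their true displacement; the increment [mean_increment s
    - D s i 0 *: delta_mx i 0] has mean zero over [i]. *)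
Definition martingale (s : seq 'I_n) : 'cV[R]_n :=
  path_sum mean_increment s - (Y s - y0).

Definition potential (x : 'cV[R]_d) (y : 'cV[R]_n) (s : seq 'I_n) : R :=
  2^-1 * (S * dotv (X s - x) (X s - x) + G * dotv (Y s - y) (Y s - y)
    + (G - S) * dotv (martingale s) (martingale s)).

Lemma potential_nil x y : potential x y [::] =
  2^-1 * (S * dotv (x0 - x) (x0 - x) + G * dotv (y0 - y) (y0 - y)).
Proof.
rewrite /potential /martingale path_sum_nil (run_x0 runXY) (run_y0 runXY).
by rewrite subrr subr0 dot0v mulr0 addr0.
Qed.

Let Gge : S <= G.
Proof. by rewrite ler_pdivlMr// ger_pMr// ltW. Qed.

(** The quadratic term of draw [i] is [S^-2 * D_i ^ 2 * |A_i| ^ 2 / p_i], and [|A_i| = S * p_i]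
    turns it into [p_i * D_i ^ 2]. *)
Lemma primal_increment_mean (a : 'cV[R]_d) s :
  \sum_i p i * dotv (a - (S^-1 / p i * D s i 0) *: (row i A)^T)
                    (a - (S^-1 / p i * D s i 0) *: (row i A)^T) =
  dotv a a - 2 * S^-1 * dotv (A *m a) (D s) + dotv (mean_increment s) (D s).
Proof.
rewrite weighted_sum_dotvD//; congr (_ + _ + _).
  have -> : \sum_i p i *: - ((S^-1 / p i * D s i 0) *: (row i A)^T) =
      - S^-1 *: (A^T *m D s).
    apply/colP => j; rewrite summxE !mxE mulr_sumr; apply: eq_bigr => i _.
    by rewrite !mxE; field; rewrite !gt_eqF.
  by rewrite dotvZr dotv_adjoint; ring.
apply: eq_bigr => i _; rewrite dotvNl dotvNr dotvZl dotvZr -enorm_sqr.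
by rewrite -/(row_norm A i) mxE /p; field; rewrite !gt_eqF.
Qed.

(** Applied with [c = 1] to the dual iterate and with [c = -1] to the martingale. *)
Lemma dual_increment_mean (a : 'cV[R]_n) (c : R) s :
  \sum_i p i * dotv (a + (c * D s i 0) *: delta_mx i 0)
                    (a + (c * D s i 0) *: delta_mx i 0) =
  dotv a a + 2 * c * dotv a (mean_increment s)
    + c ^+ 2 * dotv (mean_increment s) (D s).
Proof.
rewrite weighted_sum_dotvD//; congr (_ + _ + _).
  rewrite -mulrA; congr (2 * _); rewrite -dotvZr; congr dotv.
  apply/colP => j; rewrite summxE (bigD1 j)//= big1 => [|i ij].
    by rewrite !mxE !eqxx /= mulr1; ring.
  by rewrite !mxE eq_sym (negbTE ij) /= !mulr0.
rewrite mulr_sumr; apply: eq_bigr => i _.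
by rewrite dotvZl dotvZr dotv_delta !mxE !eqxx /= mulr1; ring.
Qed.

(** An upper bound for the gap of [g + h] between the pair ([Xb s], [dual_subgradient s]) and [x]:
    Fenchel-Young is an equality at the subgradient and an inequality at [A *m x], and the two
    conjugate values at [full_dual s] cancel. *)
Definition gain (x : 'cV[R]_d) (s : seq 'I_n) : R :=
  fine (g (Xb s)) - fine (g x) + dotv (dual_subgradient s - A *m x) (full_dual s).

Lemma potential_step x y s : g x \is a fin_num ->
  \sum_i p i * potential x y (rcons s i) + gain x s
    + G * dotv (mean_increment s) y <= potential x y s.
Proof.
move=> gx.
have -> : \sum_i p i * potential x y (rcons s i) = 2^-1 * (
    S * (\sum_i p i * dotv (Xb s - x - (S^-1 / p i * D s i 0) *: (row i A)^T)
                    (Xb s - x - (S^-1 / p i * D s i 0) *: (row i A)^T))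
    + G * (\sum_i p i * dotv (Y s - y + (1 * D s i 0) *: delta_mx i 0)
                    (Y s - y + (1 * D s i 0) *: delta_mx i 0))
    + (G - S) * (\sum_i p i *
        dotv (martingale s + mean_increment s + (- 1 * D s i 0) *: delta_mx i 0)
             (martingale s + mean_increment s + (- 1 * D s i 0) *: delta_mx i 0))).
  rewrite !mulr_sumr -!big_split mulr_sumr; apply: eq_bigr => i _ /=.
  rewrite /potential (run_x runXY) (run_y runXY).
  have -> : martingale (rcons s i) = martingale s + mean_increment s
      + (- 1 * D s i 0) *: delta_mx i 0.
    rewrite /martingale path_sum_rcons (run_y runXY).
    by apply/colP => j; rewrite !mxE; ring.
  rewrite mul1r -[Y s - y + _]addrAC -[Xb s - x - _]addrAC; ring.
rewrite primal_increment_mean !dual_increment_mean.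
have S0 : S != 0 by rewrite gt_eqF.
have := prox_scalar_variational g_proper g_convex (invr_neq0 S0)
  (run_prox runXY s) gx; rewrite invrK.
have -> : X s - S^-1 *: (A^T *m Y s) - Xb s =
    (X s - x) - (Xb s - x) - S^-1 *: (A^T *m Y s).
  by apply/colP => j; rewrite !mxE; ring.
rewrite -[x - Xb s]opprB /gain /potential /dual_subgradient /full_dual.
have -> : A *m Xb s - G *: mean_increment s - A *m x =
    A *m (Xb s - x) - G *: mean_increment s.
  by rewrite mulmxBr addrAC.
have -> : dotv (mean_increment s) y =
    dotv (mean_increment s) (Y s) - dotv (mean_increment s) (Y s - y).
  by rewrite dotvBr subKr.
move: (X s - x) (Xb s - x) (Y s - y) (martingale s) (mean_increment s) => a b u m e.
(* All terms in [dotv e (D s)] cancel; the slack of the inequality is half of this square plus half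
   of [(G - S) * dotv e e]. *)
have := mulr_ge0 (ltW S_gt0) (dotv_ge0 (a - b)).
have GS : 0 <= G - S by rewrite subr_ge0.
have := mulr_ge0 GS (dotv_ge0 e).
have SA : S * (2 * S^-1 * dotv (A *m b) (D s)) = 2 * dotv (A *m b) (D s).
  by field.
have SB : S * (S^-1 * dotv (A *m b) (Y s)) = dotv (A *m b) (Y s) by field.
rewrite !(dotvBl, dotvBr, dotvDl, dotvDr, dotvZl, dotvZr, dotvNl, dotvNr).
rewrite (dotvC (A^T *m Y s)) -dotv_adjoint (dotvC b a) (dotvC e m) (dotvC u e).
lra.
Qed.


Let p_ge0 i : 0 <= p i. Proof. exact: ltW. Qed.

(** At [y = 0] the linear term of [potential_step] vanishes. The final potential is kept on the left
    because it later absorbs the residual in the Lipschitz case. *)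
Lemma path_mean_gain K x : g x \is a fin_num ->
  path_mean p K (fun s => potential x 0 s + path_sum (gain x) s)
  <= potential x 0 [::].
Proof.
move=> gx; apply: le_trans (path_mean_supermartingale p_ge0 _ _) _; last first.
  by rewrite path_sum_nil addr0.
move=> s; have := potential_step 0 s gx; rewrite dotv0 mulr0 addr0.
have -> : \sum_i p i * (potential x 0 (rcons s i) + path_sum (gain x) (rcons s i))
    = \sum_i p i * potential x 0 (rcons s i) + (path_sum (gain x) s + gain x s).
  rewrite -[X in _ = _ + X]mul1r -p_sum mulr_suml -big_split.
  by apply: eq_bigr => i _ /=; rewrite path_sum_rcons mulrDr.
lra.
Qed.

Lemma path_sum_incrementE y s :
  path_sum mean_increment s = martingale s + (Y s - y) + (y - y0).
Proof.
rewrite /martingale; move: (path_sum _ s) => w.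
by apply/colP => i; rewrite !mxE; ring.
Qed.

(** * Moment bounds from the potential at the saddle point *)

Section Saddle.
Context (xs : 'cV[R]_d) (ys : 'cV[R]_n).
Hypotheses (hstar_proper : eproper (separable_sum hs))
  (saddle : saddle_point (lagrangian A g (separable_sum hs)) xs ys).

Let a := enorm (xs - x0).
Let b := enorm (ys - y0).

(** Here [gain xs s + G * dotv (mean_increment s) ys] is nonnegative: it splits into a monotonicity
    term of the dual subdifferential and the excess of [g + dotv (A *m _) ys] over its minimum at
    [xs]. *)
Lemma path_mean_potential_saddle K :
  path_mean p K (potential xs ys) <= potential xs ys [::].
Proof.
apply: path_mean_supermartingale => // s.
have gxs := saddle_point_primal_fin g_proper hstar_proper saddle.
have := potential_step ys s gxs.
have := saddle_point_primal g_proper hstar_proper saddle (primal_fin s).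
have := separable_subgradient_monotone (full_dual_fin s) (dual_subgradientP s)
  (saddle_point_dual_fin g_proper hstar_proper saddle)
  (saddle_point_dual g_proper hstar_proper saddle).
rewrite /gain [dotv _ (_ - ys)]dotvBr /dual_subgradient.
rewrite !(dotvBl _ _ ys) dotvZl; lra.
Qed.

Lemma path_mean_second_moment K :
  path_mean p K (fun s => enorm (Y s - ys) ^+ 2)
  + (1 - gamma) * path_mean p K (fun s => enorm (martingale s) ^+ 2)
  <= (a + b) ^+ 2.
Proof.
have := path_mean_potential_saddle K; rewrite potential_nil => H.
have : path_mean p K (fun s => 2^-1 * G * (enorm (Y s - ys) ^+ 2
    + (1 - gamma) * enorm (martingale s) ^+ 2)) <= path_mean p K (potential xs ys).
  apply: path_mean_le => // s _; rewrite !enorm_sqr /potential.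
  have GS : G - S = G * (1 - gamma).
    by rewrite mulrBr mulr1 /G divfK// gt_eqF.
  rewrite GS; have := mulr_ge0 (ltW S_gt0) (dotv_ge0 (X s - xs)); lra.
move=> /le_trans/(_ H).
rewrite path_meanZ path_meanD path_meanZ -!enorm_sqr.
rewrite -[enorm (x0 - xs)]enormN -[enorm (y0 - ys)]enormN !opprB -/a -/b.
set u := path_mean _ _ _; set v := path_mean _ _ _.
have SG : S = G * gamma by rewrite /G divfK// gt_eqF.
have G0 : 0 < G by exact: divr_gt0.
rewrite {1}SG => {}H.
have : G * (u + (1 - gamma) * v) <= G * (gamma * a ^+ 2 + b ^+ 2) by lra.
rewrite ler_pM2l// => /le_trans -> //.
have := enorm_ge0 (xs - x0); have := enorm_ge0 (ys - y0); rewrite -/a -/b.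
move=> b0 a0; have ab := mulr_ge0 a0 b0.
have : gamma * a ^+ 2 <= a ^+ 2 by rewrite ler_piMl ?sqr_ge0// ltW.
by rewrite sqrrD; lra.
Qed.

(** The sum equals [martingale s + (Y s - ys) + (ys - y0)], and each of the three terms has mean
    norm at most [(a + b) / (1 - gamma)]; hence the 3. *)
Lemma path_mean_increment_sum K :
  path_mean p K (fun s => enorm (path_sum mean_increment s))
  <= 3 * (a + b) / (1 - gamma).
Proof.
have a0 : 0 <= a by exact: enorm_ge0.
have b0 : 0 <= b by exact: enorm_ge0.
have g1 : 0 < 1 - gamma by rewrite subr_gt0.
have := path_mean_second_moment K.
set u := path_mean _ _ _; set v := path_mean _ _ _ => H.
have u0 : 0 <= u.
  rewrite -(path_mean_cst p_sum K 0); apply: path_mean_le => // s _; exact: sqr_ge0.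
have v0 : 0 <= v.
  rewrite -(path_mean_cst p_sum K 0); apply: path_mean_le => // s _; exact: sqr_ge0.
have v1 := mulr_ge0 (ltW g1) v0.
have ab0 : 0 <= a + b by exact: addr_ge0.
have HY : path_mean p K (fun s => enorm (Y s - ys)) <= a + b.
  by apply: path_mean_sqr_le => //; rewrite -/u; lra.
have HM : path_mean p K (fun s => enorm (martingale s)) <= (a + b) / (1 - gamma).
  apply: path_mean_sqr_le => //; first by rewrite divr_ge0// ltW.
  (* The second moment has only one factor [1 / (1 - gamma)]; it is weakened to its square so that
     the root is rational. *)
  rewrite -/v; apply: (@le_trans _ _ ((a + b) ^+ 2 / (1 - gamma))).
    by rewrite ler_pdivlMr// mulrC; lra.
  rewrite expr_div_n ler_wpM2l ?sqr_ge0// lef_pV2 ?posrE ?exprn_gt0//.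
  by rewrite expr2 ler_piMr ?ltW// gtrBl.
have -> : 3 * (a + b) / (1 - gamma) = 3 * ((a + b) / (1 - gamma)) by rewrite mulrA.
set q := (a + b) / (1 - gamma) in HM *.
have qE : a + b = q * (1 - gamma) by rewrite /q divfK// gt_eqF.
have q0 : 0 <= q by rewrite divr_ge0// ltW.
have gq : 0 <= q * gamma by rewrite mulr_ge0// ltW.
apply: (@le_trans _ _ (path_mean p K (fun s =>
    enorm (martingale s) + (enorm (Y s - ys) + b)))).
  apply: path_mean_le => // s _; rewrite (path_sum_incrementE ys) [leRHS]addrA.
  by apply: le_trans (enormD_le _ _) _; rewrite lerD2r enormD_le.
rewrite !path_meanD path_mean_cst//; lra.
Qed.

End Saddle.

(** * The gap at averaged points, and the Lipschitz case *)

Definition primal_mean (s : seq 'I_n) : 'cV[R]_d :=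
  (size s)%:R^-1 *: path_sum Xb s.

Definition certificate_mean (s : seq 'I_n) : 'cV[R]_n :=
  (size s)%:R^-1 *: path_sum dual_subgradient s.

Lemma certificate_meanE s : A *m primal_mean s - certificate_mean s =
  ((size s)%:R^-1 * G) *: path_sum mean_increment s.
Proof.
rewrite -scalemxAr -scalerBr -scalerA; congr (_ *: _).
rewrite mulmx_sumr -sumrB scaler_sumr; apply: eq_bigr => k _.
by rewrite subKr.
Qed.

Let h := separable_sum (fun i => conjugate (hs i)).

Lemma gap_mean_le x s : (0 < size s)%N -> g x \is a fin_num ->
  h (A *m x) \is a fin_num ->
  (g (primal_mean s) + h (certificate_mean s)
   <= (fine (g x) + fine (h (A *m x)) + (size s)%:R^-1 * path_sum (gain x) s)%:E)%E.
Proof.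
move=> s0 gx hx.
have hsN i t : hs i t != -oo%E by case: (hs_proper i).
have H1 := econvex_mean (v := fun k => Xb (take k s))
  (a := fun k => fine (g (Xb (take k s)))) g_convex _ s0.
have H2 := separable_conjugate_mean (c := fun k => dual_subgradient (take k s))
  (y := fun k => full_dual (take k s)) hsN (fun k => full_dual_fin _)
  (fun k => dual_subgradientP _) s0.
apply: le_trans (leeD (H1 _) H2) _.
  by move=> k; rewrite fineK// primal_fin.
rewrite -EFinD lee_fin -mulrDr -big_split /=.
have sn0 : (size s)%:R != 0 :> R by rewrite pnatr_eq0 -lt0n.
rewrite -[leRHS](mulKf sn0) ler_wpM2l ?invr_ge0// mulrDr mulVKf//.
have -> : (size s)%:R * (fine (g x) + fine (h (A *m x))) =
    \sum_(k < size s) (fine (g x) + fine (h (A *m x))).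
  by rewrite sumr_const card_ord mulr_natl.
rewrite -big_split; apply: ler_sum => k _ /=; rewrite /gain.
have := separable_fenchel_young (A *m x) (full_dual_fin (take k s)).
rewrite -/h -(fineK hx) lee_fin (dotvBl _ (A *m x)) /=; lra.
Qed.

(** Young's inequality is weighted so that its quadratic terms are those of the potential at
    [y = 0]. The constants in [l ^+ 2] are [2^-1 / (1 - gamma)] from the martingale, [2^-1] from
    [Y s] and 1 from [y0]. *)
Lemma lipschitz_residual_le (l : R) x s : 0 <= l -> enorm y0 <= l ->
  l * G * enorm (path_sum mean_increment s) <=
  potential x 0 s + G * (2^-1 * l ^+ 2 / (1 - gamma) + 3 / 2 * l ^+ 2).
Proof.
move=> l0 y0l; have G0 : 0 < G by exact: divr_gt0.
have g1 : 0 < 1 - gamma by rewrite subr_gt0.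
have GS : G - S = G * (1 - gamma).
  by rewrite mulrBr mulr1 /G divfK// gt_eqF.
have := mulr_ge0 (ltW S_gt0) (dotv_ge0 (X s - x)).
rewrite /potential GS -!enorm_sqr subr0.
have : enorm (path_sum mean_increment s) <=
    enorm (martingale s) + enorm (Y s) + enorm y0.
  rewrite (path_sum_incrementE 0) subr0 sub0r -(enormN y0).
  by apply: le_trans (enormD_le _ _) _; rewrite lerD2r enormD_le.
set w := enorm (path_sum _ _); set m := enorm (martingale s).
set u := enorm (Y s); set v := enorm y0 in y0l *; set z := enorm (X s - x).
move=> /(ler_wpM2l l0) H HX.
have Hv := ler_wpM2l l0 y0l.
have Hu : l * u <= 2^-1 * (l ^+ 2 + u ^+ 2) by have := sqr_ge0 (l - u); lra.
have Hm : l * m <= 2^-1 * ((1 - gamma) * m ^+ 2 + l ^+ 2 / (1 - gamma)).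
  have : 0 <= ((1 - gamma) * m - l) ^+ 2 / (1 - gamma).
    by rewrite divr_ge0 ?sqr_ge0// ltW.
  have -> : ((1 - gamma) * m - l) ^+ 2 / (1 - gamma) =
      (1 - gamma) * m ^+ 2 - 2 * (l * m) + l ^+ 2 / (1 - gamma).
    by field; rewrite gt_eqF.
  lra.
have : G * (l * w) <= G * (2^-1 * (u ^+ 2 + (1 - gamma) * m ^+ 2)
    + 2^-1 * l ^+ 2 / (1 - gamma) + 3 / 2 * l ^+ 2).
  by rewrite ler_pM2l//; lra.
lra.
Qed.


Let G_gt0 : 0 < G. Proof. exact: divr_gt0. Qed.
Let KG_ge0 (k : nat) : 0 <= k%:R^-1 * G.
Proof. by rewrite mulr_ge0 ?invr_ge0 ?(ltW G_gt0). Qed.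

Let g1_gt0 : 0 < 1 - gamma. Proof. by rewrite subr_gt0. Qed.

Lemma conjugate_sum_neqNy z : h z != -oo%E.
Proof.
have := separable_fenchel_young z (full_dual_fin [::]).
by rewrite -/h; case: (h z).
Qed.

Lemma gap_mean_fin x s : (0 < size s)%N -> g x \is a fin_num ->
  h (A *m x) \is a fin_num ->
  [/\ g (primal_mean s) \is a fin_num, h (certificate_mean s) \is a fin_num &
    fine (g (primal_mean s)) + fine (h (certificate_mean s)) <=
    fine (g x) + fine (h (A *m x)) + (size s)%:R^-1 * path_sum (gain x) s].
Proof.
move=> s0 gx hx; have := gap_mean_le s0 gx hx.
have := conjugate_sum_neqNy (certificate_mean s).
have := g_proper.1 (primal_mean s).
by case: (g _) => [u||]//; case: (h _) => [v||]//; rewrite -EFinD lee_fin.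
Qed.

Lemma convergence_rateE (c : R) (K : nat) : (0 < K)%N ->
  c * S / (K%:R * gamma * (1 - gamma)) = K%:R^-1 * (c * G / (1 - gamma)).
Proof.
by move=> K0; rewrite /G; field; rewrite !gt_eqF// ltr0n.
Qed.

(** Moving [h] from the certificate average to [A *m primal_mean s] costs the residual, which the
    potential left over in [path_mean_gain] pays for; no moment bound at a saddle point enters. *)
Lemma path_mean_lipschitz_gap (l : R) x K : (0 < K)%N -> 0 <= l -> enorm y0 <= l ->
  (forall z, h z \is a fin_num) ->
  (forall z z', `|fine (h z) - fine (h z')| <= l * enorm (z - z')) ->
  g x \is a fin_num ->
  path_mean p K (fun s => fine (h (A *m primal_mean s)) + fine (g (primal_mean s))
    - fine (h (A *m x)) - fine (g x))
  <= 2 * S / (K%:R * gamma * (1 - gamma)) * (4 * l ^+ 2 + enorm (x - x0) ^+ 2).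
Proof.
move=> K0 l0 y0l hfin hlip gx; rewrite convergence_rateE//.
have KR : 0 < K%:R :> R by rewrite ltr0n.
pose c := G * (2^-1 * l ^+ 2 / (1 - gamma) + 3 / 2 * l ^+ 2).
apply: (@le_trans _ _ (path_mean p K (fun s =>
    K%:R^-1 * (potential x 0 s + path_sum (gain x) s + c)))).
  apply: path_mean_le => // s sK; have s0 : (0 < size s)%N by rewrite sK.
  have [_ _ H] := gap_mean_fin s0 gx (hfin _).
  have := le_trans (ler_norm _) (hlip (A *m primal_mean s) (certificate_mean s)).
  rewrite certificate_meanE enormZ ger0_norm ?KG_ge0//.
  rewrite sK in H *.
  have Ki : 0 <= K%:R^-1 :> R by rewrite invr_ge0 ltW.
  have := ler_wpM2l Ki (lipschitz_residual_le x s l0 y0l).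
  rewrite -/c; lra.
rewrite path_meanZ path_meanD path_mean_cst// -[leRHS]mulrA.
rewrite ler_wpM2l ?invr_ge0 ?(ltW KR)//.
have := path_mean_gain K gx; rewrite potential_nil subr0 -!enorm_sqr.
rewrite (enormBC x0) => H.
have q1 : 1 <= (1 - gamma)^-1 by rewrite invf_ge1// lerBlDr lerDl ltW.
set q := (1 - gamma)^-1 in q1 *.
have l2 : 0 <= l ^+ 2 by exact: sqr_ge0.
have a2 : 0 <= enorm (x - x0) ^+ 2 by exact: sqr_ge0.
have y2 : enorm y0 ^+ 2 <= l ^+ 2 by rewrite ler_sqr ?nnegrE ?enorm_ge0.
have Ha : S * enorm (x - x0) ^+ 2 <= G * enorm (x - x0) ^+ 2 by rewrite ler_wpM2r.
have Hq : G * enorm (x - x0) ^+ 2 <= G * (q * enorm (x - x0) ^+ 2).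
  by rewrite ler_pM2l// ler_peMl.
have Hy : G * enorm y0 ^+ 2 <= G * l ^+ 2 by rewrite ler_pM2l.
have Hl : G * l ^+ 2 <= G * (q * l ^+ 2) by rewrite ler_pM2l// ler_peMl.
have q0 : 0 <= q by rewrite (le_trans ler01).
have := mulr_ge0 (ltW G_gt0) (mulr_ge0 q0 l2).
have := mulr_ge0 (ltW G_gt0) (mulr_ge0 q0 a2).
rewrite /c -/q; lra.
Qed.

(** * The case where [h] is the indicator of a set *)

Section SetConstraint.
Context (C : set 'cV[R]_n) (xs : 'cV[R]_d) (ys : 'cV[R]_n).
Hypotheses (hC : h = delta R C) (hstar_proper : eproper (separable_sum hs))
  (saddle : saddle_point (lagrangian A g (separable_sum hs)) xs ys).

Let L := lagrangian A g (separable_sum hs).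
Let a := enorm (xs - x0).
Let b := enorm (ys - y0).

Lemma delta_fin z : h z \is a fin_num -> z \in C /\ fine (h z) = 0.
Proof. by rewrite hC /delta; case: ifP. Qed.

Lemma saddle_point_conjugate x y : saddle_point L x y ->
  h (A *m x) = (dotv (A *m x) y - fine_sum hs y)%:E.
Proof.
move=> xy; apply: separable_conjugate_subgradient.
  exact: saddle_point_dual_fin xy.
exact: saddle_point_dual xy.
Qed.

(** Weak duality: [dotv (A *m x') y - fine_sum hs y] is at most 0 at a feasible [x'] and equals 0 at
    [x]. Consequently all saddle points share one value of [g], which allows the infimum in
    [Dstar]. *)
Lemma saddle_point_primal_value_le x y x' : saddle_point L x y ->
  g x' \is a fin_num -> h (A *m x') \is a fin_num -> fine (g x) <= fine (g x').
Proof.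
move=> xy gx' hx'; have := saddle_point_primal g_proper hstar_proper xy gx'.
have := separable_fenchel_young (A *m x')
  (saddle_point_dual_fin g_proper hstar_proper xy).
rewrite -/h -(fineK hx') lee_fin (delta_fin hx').2.
have hx : h (A *m x) \is a fin_num by rewrite (saddle_point_conjugate xy).
have := (delta_fin hx).2; rewrite (saddle_point_conjugate xy) /=; lra.
Qed.

Lemma path_mean_dist K : (0 < K)%N ->
  path_mean p K (fun s => dist (A *m primal_mean s) C)
  <= 8 * S / (K%:R * gamma * (1 - gamma)) * (a + b + enorm y0 + enorm ys).
Proof.
move=> K0; rewrite convergence_rateE//; have KR : 0 < K%:R :> R by rewrite ltr0n.
have gxs := saddle_point_primal_fin g_proper hstar_proper saddle.
have hxs : h (A *m xs) \is a fin_num by rewrite (saddle_point_conjugate saddle).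
apply: (@le_trans _ _ (path_mean p K (fun s =>
    K%:R^-1 * G * enorm (path_sum mean_increment s)))).
  apply: path_mean_le => // s sK; have s0 : (0 < size s)%N by rewrite sK.
  have [_ /delta_fin[cC _] _] := gap_mean_fin s0 gxs hxs.
  rewrite -sK -[X in X * enorm _]ger0_norm ?KG_ge0//.
  rewrite -enormZ -certificate_meanE; apply: ge_inf; last first.
    by exists (certificate_mean s) => //; exact: set_mem.
  by exists 0 => _ [z _ <-]; exact: enorm_ge0.
rewrite path_meanZ -[leLHS]mulrA -[leRHS]mulrA ler_wpM2l ?invr_ge0 ?(ltW KR)//.
have := path_mean_increment_sum hstar_proper saddle K; rewrite -/a -/b.
set q := (1 - gamma)^-1 => /(ler_wpM2l (ltW G_gt0)).
have q0 : 0 <= q by rewrite invr_ge0 ltW.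
have tp t (t0 : 0 <= t) : 0 <= G * (q * t) :=
  mulr_ge0 (ltW G_gt0) (mulr_ge0 q0 t0).
have := tp _ (enorm_ge0 (xs - x0)); have := tp _ (enorm_ge0 (ys - y0)).
have := tp _ (enorm_ge0 y0); have := tp _ (enorm_ge0 ys); rewrite -/a -/b.
lra.
Qed.

Lemma path_mean_primal_value K x y : (0 < K)%N -> saddle_point L x y ->
  path_mean p K (fun s => `|fine (g (primal_mean s)) - fine (g xs)|)
  <= K%:R^-1 * (2^-1 * (S * enorm (x - x0) ^+ 2 + G * enorm y0 ^+ 2)
     + 6 * G * enorm ys * (a + b) / (1 - gamma)).
Proof.
move=> K0 xy; have KR : 0 < K%:R :> R by rewrite ltr0n.
have gxs := saddle_point_primal_fin g_proper hstar_proper saddle.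
have hxs : h (A *m xs) \is a fin_num by rewrite (saddle_point_conjugate saddle).
have gx := saddle_point_primal_fin g_proper hstar_proper xy.
have hx : h (A *m x) \is a fin_num by rewrite (saddle_point_conjugate xy).
have gE : fine (g x) = fine (g xs).
  apply/eqP; rewrite eq_le (saddle_point_primal_value_le xy gxs hxs).
  by rewrite (saddle_point_primal_value_le saddle gx hx).
(* With residual [r = enorm ys * G * enorm (path_sum mean_increment s)], the value gap lies between
   [- r / K] and [path_sum (gain x) s / K]. The accumulated gain may thus be as low as [- r], so the
   absolute value needs [2 * r]. *)
apply: (@le_trans _ _ (path_mean p K (fun s =>
    K%:R^-1 * (potential x 0 s + path_sum (gain x) s
      + 2 * enorm ys * G * enorm (path_sum mean_increment s))))).
  apply: path_mean_le => // s sK; have s0 : (0 < size s)%N by rewrite sK.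
  have [gm hm] := gap_mean_fin s0 gx hx.
  rewrite (delta_fin hm).2 (delta_fin hx).2 gE !addr0 => H.
  have p0 : 0 <= K%:R^-1 * potential x 0 s.
    rewrite mulr_ge0 ?invr_ge0 ?(ltW KR)// /potential mulr_ge0//.
    by rewrite !addr_ge0// mulr_ge0 ?dotv_ge0// ?subr_ge0// ltW.
  have := saddle_point_primal g_proper hstar_proper saddle gm.
  have := separable_fenchel_young (certificate_mean s)
    (saddle_point_dual_fin g_proper hstar_proper saddle).
  rewrite -/h -(fineK hm) lee_fin (delta_fin hm).2.
  have := (delta_fin hxs).2; rewrite (saddle_point_conjugate saddle) /=.
  have := dotv_le (A *m primal_mean s - certificate_mean s) ys.
  rewrite (dotvBl (A *m primal_mean s)) certificate_meanE enormZ.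
  rewrite ger0_norm ?KG_ge0//.
  have : 0 <= (size s)%:R^-1 * G * enorm (path_sum mean_increment s) * enorm ys.
    by rewrite mulr_ge0 ?enorm_ge0// mulr_ge0 ?enorm_ge0 ?KG_ge0.
  rewrite sK in H * => H1 H2 H3 H4 H5.
  by rewrite ler_norml; apply/andP; split; lra.
rewrite path_meanZ path_meanD path_meanZ ler_wpM2l ?invr_ge0 ?(ltW KR)//.
apply: lerD.
  have := path_mean_gain K gx; rewrite potential_nil subr0 -!enorm_sqr.
  by rewrite (enormBC x0).
have := path_mean_increment_sum hstar_proper saddle K; rewrite -/a -/b.
have c0 : 0 <= 2 * enorm ys * G by rewrite mulr_ge0 ?(ltW G_gt0)// mulr_ge0 ?enorm_ge0.
by move=> /(ler_wpM2l c0) H; lra.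
Qed.

Lemma path_mean_set_gap K : (0 < K)%N ->
  path_mean p K (fun s => `|fine (g (primal_mean s)) - fine (g xs)|)
  <= 8 * S / (K%:R * gamma * (1 - gamma))
     * ((a + b + enorm y0 + enorm ys) * enorm ys + Dstar L x0 y0 + enorm y0 ^+ 2).
Proof.
move=> K0; rewrite convergence_rateE//; have KR : 0 < K%:R :> R by rewrite ltr0n.
have H x y := @path_mean_primal_value K x y K0.
set E := path_mean _ _ _ in H *.
pose c := 2^-1 * (G * enorm y0 ^+ 2) + 6 * G * enorm ys * (a + b) / (1 - gamma).
have D0 : 0 <= Dstar L x0 y0.
  apply: lb_le_inf; first by eexists; exists (xs, ys).
  by move=> _ [z _ <-]; rewrite addr_ge0 ?sqr_ge0.
(* The bound of [path_mean_primal_value] is solved for [enorm (x - x0) ^+ 2], so that its left side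
   is a lower bound over all saddle points and passes to the infimum. *)
have : (K%:R * E - c) / (2^-1 * S) <= Dstar L x0 y0.
  apply: lb_le_inf; first by eexists; exists (xs, ys).
  move=> _ [[x y] /= xy <-]; apply: (@le_trans _ _ (enorm (x - x0) ^+ 2)); last first.
    by rewrite lerDl sqr_ge0.
  rewrite ler_pdivrMr ?mulr_gt0// lerBlDr -(@ler_pM2l _ K%:R^-1) ?invr_gt0//.
  by rewrite mulKf ?gt_eqF//; apply: le_trans (H x y xy) _; rewrite /c; lra.
rewrite ler_pdivrMr ?mulr_gt0// => {}H.
rewrite -[leRHS]mulrA -[leLHS](mulKf (_ : K%:R != 0)) ?gt_eqF// ler_pM2l ?invr_gt0//.
set Ds := Dstar _ _ _ in H D0 *; set q := (1 - gamma)^-1 in c H *.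
have q1 : 1 <= q by rewrite invf_ge1// lerBlDr lerDl ltW.
have q0 : 0 <= q by rewrite (le_trans ler01).
have tq t : 0 <= t -> G * t <= G * (q * t).
  by move=> t0; rewrite ler_pM2l// ler_peMl.
have tp t (t0 : 0 <= t) : 0 <= G * (q * t) :=
  mulr_ge0 (ltW G_gt0) (mulr_ge0 q0 t0).
have H1 := tq _ D0; have H2 := tq _ (sqr_ge0 (enorm y0)).
have H3 := tp _ D0; have H4 := tp _ (sqr_ge0 (enorm y0)).
have H5 := ler_wpM2r D0 Gge.
have H6 := tp _ (mulr_ge0 (enorm_ge0 ys) (enorm_ge0 ys)).
have H7 := tp _ (mulr_ge0 (enorm_ge0 y0) (enorm_ge0 ys)).
have H8 := tp _ (mulr_ge0 (enorm_ge0 (xs - x0)) (enorm_ge0 ys)).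
have H9 := tp _ (mulr_ge0 (enorm_ge0 (ys - y0)) (enorm_ge0 ys)).
rewrite -/a in H8; rewrite -/b in H9.
rewrite /c in H; lra.
Qed.

End SetConstraint.
End Potential.

(** * Dual domain of a Lipschitz function, and the final assembly *)

(** Along the ray [t *: y], Fenchel-Young makes [h] grow at rate [enorm y ^+ 2], the Lipschitz bound
    at most at rate [l * enorm y]. The value [t = c / e] makes the difference exceed the constants
    by 1. Applied to [y0], this removes [y0] from the first rate. *)
Lemma lipschitz_conjugate_dom (R : realType) (n : nat) (hs : 'I_n -> R -> \bar R)
    (h := separable_sum (fun i => conjugate (hs i))) (l : R) (y : 'cV[R]_n) :
  (forall z, h z \is a fin_num) ->
  (forall z z', `|fine (h z) - fine (h z')| <= l * enorm (z - z')) ->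
  (forall i, hs i (y i 0) \is a fin_num) -> 0 <= l -> enorm y <= l.
Proof.
move=> hfin hlip yf l0; rewrite leNgt; apply/negP => ly.
pose e := enorm y ^+ 2 - l * enorm y.
have y0 : 0 < enorm y by exact: le_lt_trans ly.
have e0 : 0 < e by rewrite /e expr2 -mulrBl mulr_gt0// subr_gt0.
pose c := `|fine (h 0) + fine_sum hs y| + 1.
have t0 : 0 <= c / e by rewrite divr_ge0 ?(ltW e0)// addr_ge0.
have := separable_fenchel_young ((c / e) *: y) yf.
rewrite -/h -(fineK (hfin _)) lee_fin dotvZl -enorm_sqr => H.
have := le_trans (ler_norm _) (hlip ((c / e) *: y) 0).
rewrite subr0 enormZ ger0_norm//; move: H.
have : c / e * (enorm y ^+ 2 - l * enorm y) = `|fine (h 0) + fine_sum hs y| + 1.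
  by rewrite -/e divfK// gt_eqF.
have := ler_norm (fine (h 0) + fine_sum hs y).
move: (c / e) => t; lra.
Qed.

Lemma lipschitz_enorm_ge0 (R : realType) (n : nat) (f : 'cV[R]_n -> R) (l : R)
    (i : 'I_n) :
  (forall z z', `|f z - f z'| <= l * enorm (z - z')) -> 0 <= l.
Proof.
move=> /(_ (delta_mx i 0) 0); rewrite subr0 => /(le_trans (normr_ge0 _)).
rewrite pmulr_lge0// lt0r enorm_ge0 andbT enorm_eq0; apply/eqP => /colP/(_ i).
by rewrite !mxE !eqxx => /eqP; rewrite oner_eq0.
Qed.

Theorem theorem3p5 (R : realType) (n d : nat) (A : 'M[R]_(n, d))
    (g : 'cV[R]_d -> \bar R) (hs : 'I_n -> R -> \bar R)
    (hstar := separable_sum hs)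
    (h := separable_sum (fun i => conjugate (hs i)))
    (L := lagrangian A g hstar)
    (g_proper : eproper g) (g_convex : econvex g)
    (g_lsc : lower_semicontinuous g)
    (hstar_proper : eproper hstar) (hstar_convex : econvex hstar)
    (hstar_lsc : lower_semicontinuous hstar)
    (A_rows : forall i : 'I_n, row i A != 0)
    (gamma : R) (gamma_range : 0 < gamma < 1)
    (S := \sum_(i < n) row_norm A i)
    (tau := S^-1)
    (sigma := fun i : 'I_n => gamma / row_norm A i)
    (p := fun i : 'I_n => row_norm A i / S)
    (disp : measure_display) (Omega : measurableType disp)
    (P : probability Omega R) (idx : nat -> Omega -> 'I_n)
    (idx_random : random_indices P p idx)
    (x0 : 'cV[R]_d) (y0 : 'cV[R]_n)
    (x0_dom : edom g x0) (y0_dom : edom hstar y0)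
    (x xbar : nat -> Omega -> 'cV[R]_d) (y : nat -> Omega -> 'cV[R]_n)
    (run : forall w : Omega,
      pure_cd A g hs (fun=> tau%:M) (fun=> diag_mx (\row_i sigma i))
        (fun=> 1%:M) p x0 y0 (fun k => idx k w)
        (fun k => x k w) (fun k => xbar k w) (fun k => y k w))
    (xK := fun (K : nat) (w : Omega) => ergodic_mean (fun k => xbar k w) K)
    (xs : 'cV[R]_d) (ys : 'cV[R]_n) (saddle : saddle_point L xs ys) :
  (forall Lh : R,
     (forall z, h z \is a fin_num) ->
     (forall z z', `|fine (h z) - fine (h z')| <= Lh * enorm (z - z')) ->
     forall K : nat, (1 <= K)%N ->
       (\int[P]_w (h (A *m xK K w) + g (xK K w) - h (A *m xs) - g xs)
        <= (2 * S / (K%:R * gamma * (1 - gamma))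
            * (4 * Lh ^+ 2 + enorm (xs - x0) ^+ 2))%:E)%E)
  /\
  (forall C_ : 'I_n -> set R,
     let C := [set z : 'cV[R]_n | forall i, C_ i (z i 0)] in
     C !=set0 -> closed C -> convex_set (C : set (convex_lmodType 'cV[R]_n)) ->
     h = delta R C ->
     forall K : nat, (1 <= K)%N ->
       (\int[P]_w `|g (xK K w) - g xs|
        <= (8 * S / (K%:R * gamma * (1 - gamma))
            * ((enorm (xs - x0) + enorm (ys - y0) + enorm y0 + enorm ys)
                 * enorm ys
               + Dstar L x0 y0 + enorm y0 ^+ 2))%:E)%E
       /\
       (\int[P]_w (dist (A *m xK K w) C)%:E
        <= (8 * S / (K%:R * gamma * (1 - gamma))
            * (enorm (xs - x0) + enorm (ys - y0) + enorm y0 + enorm ys))%:E)%E).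
Proof.
have /andP[gamma_gt0 gamma_lt1] := gamma_range.
have rows_gt0 i : 0 < row_norm A i.
  by rewrite lt0r enorm_ge0 andbT enorm_eq0 trmx_eq0.
have S_gt0i (i : 'I_n) : 0 < S.
  rewrite /S (bigD1 i)//= ltr_wpDr//; apply: sumr_ge0 => j _; exact: ltW.
have p_gt0 i : 0 < p i by rewrite divr_gt0// (S_gt0i i).
have witness s := history_witness idx_random s p_gt0.
(* A sample point yields an index [idx 0 w0], so [n] is positive and [S] nonzero. *)
have [w0 _] := witness [::].
have S_gt0 := S_gt0i (idx 0%N w0).
have hsN i t : hs i t != -oo%E by apply: separable_coord_neqNy; case: hstar_proper.
have y0_fin := separable_sum_gtNy hsN y0_dom.
have hs_proper i : eproper (hs i).
  by split; [exact: hsN | exists (y0 i 0); rewrite ltey_eq y0_fin].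
have hs_convex i : econvex (V := R^o) (hs i) by exact: separable_coord_convex.
have sigma_gt0 i : 0 < sigma i by exact: divr_gt0.
have tau_gt0 : 0 < tau by rewrite invr_gt0.
have [X [Xb [Y [D [runXY xbarE]]]]] := history_runP g_proper g_convex hs_proper
  hs_convex tau_gt0 sigma_gt0 p_gt0 witness run.
have xKE K w : xK K w = primal_mean Xb (history idx K w).
  rewrite /xK /ergodic_mean /primal_mean /path_sum size_history; congr (_ *: _).
  (* The average runs over [xbar 1] to [xbar K], and [xbar k.+1] depends on the first [k] draws
     only; after the shift these are the proper prefixes of the history. *)
  rewrite big_add1 big_mkord; apply: eq_bigr => k _.
  by rewrite xbarE take_history// ltnW.
have gxs := saddle_point_primal_fin g_proper hstar_proper saddle.
have hxs : h (A *m xs) \is a fin_num.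
  by rewrite /h (saddle_point_conjugate g_proper hstar_proper saddle).
have gm_fin K w : (0 < K)%N -> g (xK K w) \is a fin_num.
  move=> K0; rewrite xKE.
  have [|//] := gap_mean_fin g_proper g_convex hs_proper hs_convex rows_gt0 S_gt0
    gamma_gt0 runXY (s := history idx K w) _ gxs hxs.
  by rewrite size_history.
split=> [Lh hfin hlip K K0|C_ C _ _ _ hC K K0].
  have Lh0 := lipschitz_enorm_ge0 (idx 0%N w0) hlip.
  have y0L := lipschitz_conjugate_dom hfin hlip y0_fin Lh0.
  under eq_integral do rewrite -(fineK (hfin _)) -(fineK (gm_fin _ _ K0))
    -(fineK hxs) -(fineK gxs) -!EFinD xKE.
  rewrite (integral_history idx_random K (fun s => fine (h (A *m primal_mean Xb s))
    + fine (g (primal_mean Xb s)) - fine (h (A *m xs)) - fine (g xs))) lee_fin.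
  exact: (path_mean_lipschitz_gap g_proper g_convex hs_proper hs_convex rows_gt0
    S_gt0 gamma_gt0 gamma_lt1 runXY K0 Lh0 y0L hfin hlip gxs).
split.
  under eq_integral do rewrite -(fineK (gm_fin _ _ K0)) -(fineK gxs) -EFinD xKE.
  rewrite (integral_history idx_random K (fun s =>
    `|fine (g (primal_mean Xb s)) - fine (g xs)|)) lee_fin.
  exact: (path_mean_set_gap g_proper g_convex hs_proper hs_convex rows_gt0
    S_gt0 gamma_gt0 gamma_lt1 runXY hC hstar_proper saddle K0).
under eq_integral do rewrite xKE.
rewrite (integral_history idx_random K (fun s => dist (A *m primal_mean Xb s) C)).
rewrite lee_fin.
exact: (path_mean_dist g_proper g_convex hs_proper hs_convex rows_gt0
  S_gt0 gamma_gt0 gamma_lt1 runXY hC hstar_proper saddle K0).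
Qed.
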